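(* For every integer $h'\geq 1$ there exists an integer $\nu=\nu(h')\geq 1$ with the following property. Let $G$ be a connected graph with no clique of cardinality $h'$. Let $S'\subseteq V(G)$ be such that $|S'|\geq\nu$, $G\setminus S'$ is connected, and every vertex of $S'$ has a neighbor in $G\setminus S'$. Then there is a set $\tilde S\subseteq S'$ with $|\tilde S|=h'$ and an induced subgraph $H'$ of $G\setminus S'$ for which one of the following holds: (i) $H'$ is a path and every vertex of $\tilde S$ has a neighbor in $H'$; or (ii) $H'$ is a caterpillar, or the line graph of a caterpillar, or a subdivided star; moreover every vertex of $\tilde S$ has a unique neighbor in $H'$, and $V(H')\cap N(\tilde S)=\mathcal{Z}(H')$.
   Context: Graphs are finite and simple; a path is an induced path. A branch vertex is a vertex of degree more than two. A caterpillar is a tree of maximum degree three such that some path of it contains all its branch vertices. A subdivided star is a graph isomorphic to a subdivision of $K_{1,\delta}$ for some $\delta\geq 3$. A vertex of a graph $H$ is simplicial if its neighborhood in $H$ is a clique; $\mathcal{Z}(H)$ denotes the set of simplicial vertices of $H$. For a set $X$, $N(X)$ is the set of vertices not in $X$ having a neighbor in $X$. *)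

(* Defs.v *)
From HB Require Import structures.
From mathcomp Require Import all_boot.

Set Implicit Arguments.
Unset Strict Implicit.
Unset Printing Implicit Defensive.

Record sgraph := SGraph {
  vertex :> finType;
  adj : rel vertex;
  adj_sym : symmetric adj;
  adj_irr : irreflexive adj }.

Arguments adj {s}.

Definition iso (G H : sgraph) : Prop :=
  exists f : G -> H, bijective f /\ forall x y, adj (f x) (f y) = adj x y.

Section Induced.
Variables (G : sgraph) (A : {set G}).
Definition induced_adj : rel {x : G | x \in A} :=
  fun x y => adj (val x) (val y).
Fact induced_sym : symmetric induced_adj.
Proof. by move=> x y; apply: adj_sym. Qed.
Fact induced_irr : irreflexive induced_adj.
Proof. by move=> x; apply: adj_irr. Qed.
Definition induced : sgraph := SGraph induced_sym induced_irr.
End Induced.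

Definition clique (G : sgraph) (K : {set G}) : Prop :=
  {in K &, forall x y, x != y -> adj x y}.

Definition nbhd (G : sgraph) (x : G) : {set G} := [set y | adj x y].

Definition set_nbhd (G : sgraph) (X : {set G}) : {set G} :=
  [set y | (y \notin X) && [exists x in X, adj x y]].

Definition degree (G : sgraph) (x : G) : nat := #|nbhd x|.

Definition max_degree (G : sgraph) : nat := \max_(x : G) degree x.

Definition branch_vertex (G : sgraph) (x : G) : Prop := 2 < degree x.

Definition connected_graph (G : sgraph) : Prop :=
  0 < #|G| /\ forall x y : G, connect adj x y.

(* [ucycle adj c] also holds when c is empty or lists the two ends of an edge;
   graph cycles have length at least 3. *)
Definition acyclic (G : sgraph) : Prop :=
  forall c : seq G, ucycle adj c -> size c < 3.

Definition is_tree (G : sgraph) : Prop := connected_graph G /\ acyclic G.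

Section PathGraph.
Variable n : nat.
Definition path_adj : rel 'I_n :=
  fun i j => (i.+1 == j :> nat) || (j.+1 == i :> nat).
Fact path_sym : symmetric path_adj.
Proof. by move=> i j; rewrite /path_adj orbC. Qed.
Fact path_irr : irreflexive path_adj.
Proof. by move=> i; rewrite /path_adj orbb; apply/negbTE; rewrite gtn_eqF. Qed.
Definition path_graph : sgraph := SGraph path_sym path_irr.
End PathGraph.

Definition is_path (G : sgraph) : Prop :=
  exists n : nat, 0 < n /\ iso G (path_graph n).

Definition is_caterpillar (C : sgraph) : Prop :=
  [/\ is_tree C, max_degree C = 3 &
      exists P : {set C}, is_path (induced P) /\
        forall x : C, branch_vertex x -> x \in P].

Section LineGraph.
Variable G : sgraph.
Definition is_edge (e : {set G}) : bool :=
  [exists x, exists y, adj x y && (e == [set x; y])].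
Definition line_adj : rel {e : {set G} | is_edge e} :=
  fun e f => (e != f) && (val e :&: val f != set0).
Fact line_sym : symmetric line_adj.
Proof. by move=> e f; rewrite /line_adj eq_sym setIC. Qed.
Fact line_irr : irreflexive line_adj.
Proof. by move=> e; rewrite /line_adj eqxx. Qed.
Definition line_graph : sgraph := SGraph line_sym line_irr.
End LineGraph.

Definition is_line_graph_of_caterpillar (H : sgraph) : Prop :=
  exists C : sgraph, is_caterpillar C /\ iso H (line_graph C).

(* Subdividing the edge xy once: [None] is the new vertex. *)
Section SubdivideEdge.
Variables (G : sgraph) (x y : G).
Definition subdivide_adj : rel (option G) := fun u v =>
  match u, v with
  | Some a, Some b => adj a b && ([set a; b] != [set x; y])
  | Some a, None | None, Some a => a \in [set x; y]
  | None, None => false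
  end.
Fact subdivide_sym : symmetric subdivide_adj.
Proof. by move=> [a|] [b|] //=; rewrite adj_sym setUC. Qed.
Fact subdivide_irr : irreflexive subdivide_adj.
Proof. by move=> [a|] //=; rewrite adj_irr. Qed.
Definition subdivide_edge : sgraph := SGraph subdivide_sym subdivide_irr.
End SubdivideEdge.

(* [subdivision G H]: up to isomorphism, H arises from G by finitely many
   (possibly zero) edge subdivisions. *)
Inductive subdivision (G : sgraph) : sgraph -> Prop :=
| subdivision_iso (H : sgraph) : iso H G -> subdivision G H
| subdivision_step (H H' : sgraph) (x y : H) :
    subdivision G H -> adj x y -> iso H' (subdivide_edge x y) ->
    subdivision G H'.

(* K_{1,d}, with center [None]. *)
Section Star.
Variable d : nat.
Definition star_adj : rel (option 'I_d) := fun u v => isSome u (+) isSome v.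
Fact star_sym : symmetric star_adj.
Proof. by move=> u v; apply: addbC. Qed.
Fact star_irr : irreflexive star_adj.
Proof. by move=> u; apply: addbb. Qed.
Definition star : sgraph := SGraph star_sym star_irr.
End Star.

Definition is_subdivided_star (H : sgraph) : Prop :=
  exists d : nat, 3 <= d /\ subdivision (star d) H.

Definition simplicials (H : sgraph) : {set H} :=
  [set x | [forall y in nbhd x, forall z in nbhd x, (y != z) ==> adj y z]].

(* Main.v *)
Require Import Defs.
From HB Require Import structures.
From mathcomp Require Import all_boot.
From mathcomp Require Import zify.

(** Let A be a minimal connected subset of the complement of S' in which every
    vertex of S' has a neighbor, and call a vertex x of A private if some s in S'
    has x as its only neighbor in A. By minimality every non-cut vertex of A is
    private. Fix a breadth-first tree of A. From a vertex w adjacent to a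
    connected set K containing the root there hangs a "hair": a descending tree
    path from w to a private vertex which, past w, stays inside the part of A
    separated from K by w. Hairs with non-adjacent roots are therefore
    anticomplete to each other.

    If a vertex of A has large degree, Ramsey's theorem gives many pairwise
    non-adjacent neighbors, and the hairs from them form a subdivided star.
    Otherwise, starting at a private root, descending each time to the child with
    the most terminals below it gives a geodesic tree path P along which terminals
    attach or the tree branches many times. If P sees few terminals, it branches
    often. A child w off P of a branching vertex x_i can be adjacent only to x_i,
    x_(i+1) and x_(i+2). If it is adjacent to x_(i+2), then x_(i+1) is private or
    has a hair of its own attached only there; otherwise w is attached to x_i
    alone or to x_i and x_(i+1). Many hairs of the first kind form with P a
    caterpillar, many of the second kind the line graph of one. *)

Set Implicit Arguments.
Unset Strict Implicit.
Unset Printing Implicit Defensive.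

(** * Ramsey's theorem, paths and trees *)

Lemma exists_subset_card (T : finType) (B : {set T}) k :
  k <= #|B| -> exists2 C : {set T}, C \subset B & #|C| = k.
Proof.
move=> leB; exists [set x in take k (enum B)].
  by apply/subsetP=> x; rewrite inE => /mem_take; rewrite mem_enum.
rewrite cardsE; have/card_uniqP -> : uniq (take k (enum B)).
  by rewrite take_uniq ?enum_uniq.
by rewrite size_take -cardE; case: ltngtP leB.
Qed.

Definition stable (G : sgraph) (I : {set G}) : Prop :=
  {in I &, forall x y, ~~ adj x y}.

(** Induction on [a + b]: once a vertex [v] of [W] is deleted, its neighbors or its non-neighbors
    meet the halved bound, and [v] extends a clique found among the former or a stable set found
    among the latter. *)
Lemma ramsey (G : sgraph) a b (W : {set G}) : 2 ^ (a + b) <= #|W| ->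
  (exists K : {set G}, [/\ K \subset W, clique K & #|K| = a]) \/
  (exists I : {set G}, [/\ I \subset W, stable I & #|I| = b]).
Proof.
move defn: (a + b) => n leW; elim: n a b defn W leW => [|n IHn] a b defn W leW.
  case: a defn => // _; left; exists set0.
  by rewrite sub0set cards0; split=> // x y; rewrite inE.
case: a defn => [|a] defn.
  by left; exists set0; rewrite sub0set cards0; split=> // x y; rewrite inE.
case: b defn => [|b] defn.
  by right; exists set0; rewrite sub0set cards0; split=> // x y; rewrite inE.
have /card_gt0P[v Wv] : 0 < #|W| by apply: leq_trans leW; rewrite expn_gt0.
pose N := [set y in W :\ v | adj v y]; pose M := [set y in W :\ v | ~~ adj v y].
have cardNM : #|N| + #|M| = #|W|.-1.
  rewrite (cardsD1 v W) Wv /= -cardsUI.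
  have -> : N :&: M = set0.
    by apply/setP=> y; rewrite !inE; case: adj; rewrite ?andbF.
  rewrite cards0 addn0; apply: eq_card => y.
  by rewrite !inE; case: adj; rewrite ?andbT ?andbF ?orbF.
have [leN|ltN] := leqP (2 ^ n) #|N|.
  have [|[K [sKN cK cardK]]|[I [sIN sI cardI]]] := IHn a b.+1 _ N leN; first lia.
    left; exists (v |: K); split.
    - rewrite subUset sub1set Wv /=; apply: subset_trans sKN _.
      by apply/subsetP=> y; rewrite !inE => /andP[/andP[]].
    - have vK y : y \in K -> adj v y by move=> /(subsetP sKN); rewrite !inE => /andP[].
      move=> x y /setU1P[->|Kx] /setU1P[->|Ky]; rewrite ?eqxx // => nxy.
      + exact: vK.
      + by rewrite adj_sym vK.
      + exact: cK.
    - rewrite cardsU1 cardK; case: (boolP (v \in K)) => // /(subsetP sKN).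
      by rewrite !inE eqxx.
  right; exists I; split=> //; apply: subset_trans sIN _.
  by apply/subsetP=> y; rewrite !inE => /andP[/andP[]].
have leM : 2 ^ n <= #|M| by move: leW; rewrite expnS; lia.
have [|[K [sKN cK cardK]]|[I [sIN sI cardI]]] := IHn a.+1 b _ M leM; first lia.
  left; exists K; split=> //; apply: subset_trans sKN _.
  by apply/subsetP=> y; rewrite !inE => /andP[/andP[]].
right; exists (v |: I); split.
- rewrite subUset sub1set Wv /=; apply: subset_trans sIN _.
  by apply/subsetP=> y; rewrite !inE => /andP[/andP[]].
- have vI y : y \in I -> ~~ adj v y by move=> /(subsetP sIN); rewrite !inE => /andP[].
  move=> x y /setU1P[->|Kx] /setU1P[->|Ky].
  + by rewrite adj_irr.
  + exact: vI.
  + by rewrite adj_sym vI.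
  + exact: sI.
- rewrite cardsU1 cardI; case: (boolP (v \in I)) => // /(subsetP sIN).
  by rewrite !inE eqxx.
Qed.

(** The values of [c] on [P] are distinct and closed under predecessor, so they are exactly the
    numbers below [#|P|], and [c] itself is the isomorphism. *)
Lemma path_of_code (G : sgraph) (P : {set G}) (c : G -> nat) :
    0 < #|P| -> {in P &, injective c} ->
    (forall x i, x \in P -> c x = i.+1 -> exists2 y, y \in P & c y = i) ->
    {in P &, forall x y, adj x y = ((c x).+1 == c y) || ((c y).+1 == c x)} ->
  is_path (induced P).
Proof.
move=> P_gt0 injc downc adjc; exists #|P|; split=> //.
have lti i : forall x, x \in P -> c x = i -> i < #|[set y in P | c y <= i]|.
  elim: i => [|i IHi] x Px cx.
    by rewrite card_gt0; apply/set0Pn; exists x; rewrite inE Px cx.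
  have [y Py cy] := downc _ _ Px cx.
  rewrite (cardsD1 x) inE Px cx leqnn /= add1n ltnS (leq_trans (IHi y Py cy)) //.
  apply/subset_leq_card/subsetP=> z; rewrite !inE => /andP[-> cz].
  by rewrite leqW ?andbT //; apply: contraTneq cz => ->; rewrite cx ltnn.
have ltc x : x \in P -> c x < #|P|.
  move=> Px; apply: leq_trans (lti _ _ Px erefl) _.
  by apply/subset_leq_card/subsetP=> y; rewrite inE => /andP[].
pose f (x : induced P) : path_graph #|P| := Ordinal (ltc (val x) (valP x)).
exists f; split=> [|x y]; last first.
  by rewrite /= /path_adj /= /induced_adj adjc ?(valP x) ?(valP y).
apply: inj_card_bij => [x y [exy]|].
  by apply/val_inj/injc => //; [apply: (valP x) | apply: (valP y)].
by rewrite card_ord card_sig.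
Qed.

(** On a cycle of length at least three, a vertex of maximal rank has two distinct neighbors of no
    larger rank. *)
Lemma acyclic_of_rank (G : sgraph) (rk : G -> nat) :
    (forall x y z, adj x y -> adj x z -> rk y <= rk x -> rk z <= rk x -> y = z) ->
  acyclic G.
Proof.
move=> uniq_down c /andP[cyc_c uniq_c]; rewrite ltnNge; apply/negP=> c_ge3.
have [x0 cx0] : exists x, x \in c by case: (c) c_ge3 => // x ? _; exists x; rewrite mem_head.
pose x := [arg max_(x > x0 in c) rk x].
have [cx maxx] : x \in c /\ {in c, forall y, rk y <= rk x}.
  by rewrite /x; case: arg_maxnP.
have [i s def_c] := rot_to cx.
have uniq_s : uniq (x :: s) by rewrite -def_c rot_uniq.
have cyc_s : cycle adj (x :: s) by rewrite -def_c rot_cycle.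
have mem_s : {subset s <= c}.
  by move=> y sy; rewrite -(mem_rot i) def_c inE sy orbT.
have: 2 < size (x :: s) by rewrite -def_c size_rot.
case: s uniq_s {def_c} cyc_s mem_s => [|y [|z s]] //= /and4P[_ nys _ _].
rewrite rcons_path => /and4P[xy _ _ zx] mem_s _.
case/negP: nys; rewrite (uniq_down x y (last z s)) ?mem_last //.
- by rewrite adj_sym.
- by rewrite maxx ?mem_s ?mem_head.
- by rewrite maxx // mem_s // inE mem_last orbT.
Qed.

(** * Combs, caterpillars and their line graphs *)

(* A comb is coded by pairs: (i, 0) is the i-th spine vertex and (i, j) with
   0 < j is the j-th vertex of the tooth hanging at (i, 0). *)
Definition comb_parent (a b : nat * nat) : bool :=
  ((b.1 == a.1) && (b.2 == a.2.+1)) || [&& b.1 == a.1.+1, a.2 == 0 & b.2 == 0].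

(** The spine vertex and the tooth vertex with common parent [(b.1, 0)]; the edges leading to them
    meet there. *)
Definition comb_sibling (a b : nat * nat) : bool :=
  [&& a.1 == b.1.+1, a.2 == 0 & b.2 == 1].

(* With [l] set, this is the adjacency of the edges of the comb, each edge being
   named by its end farther from the root (0, 0). *)
Definition comb_adj (l : bool) (a b : nat * nat) : bool :=
  [|| comb_parent a b, comb_parent b a |
      l && (comb_sibling a b || comb_sibling b a)].

Ltac comb_lia :=
  rewrite /comb_adj /comb_parent /comb_sibling /=; lia.

Lemma comb_adj_sym l : symmetric (comb_adj l).
Proof. by move=> a b; rewrite /comb_adj orbCA [_ || comb_sibling b a]orbC. Qed.

Lemma comb_adj_irr l : irreflexive (comb_adj l).
Proof. by move=> a; comb_lia. Qed.

Lemma pair_nat_eq (a b : nat * nat) : a.1 = b.1 -> a.2 = b.2 -> a = b.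
Proof. by case: a b => [? ?] [? ?] /= -> ->. Qed.

(** The sum of the coordinates drops by one from a vertex to its parent. Climbing therefore ends at
    [r], and a neighbor of no larger sum can only be the parent, of which there is one. *)
Lemma comb_tree (C : sgraph) (c : C -> nat * nat) (r : C) :
    injective c -> c r = (0, 0) ->
    (forall y, y != r -> exists x, comb_parent (c x) (c y)) ->
    (forall x y, adj x y = comb_adj false (c x) (c y)) ->
  is_tree C.
Proof.
move=> injc cr parc adjc; split.
  split; first by apply/card_gt0P; exists r.
  have to_r n : forall x, (c x).1 + (c x).2 <= n -> connect adj x r.
    elim: n => [|n IHn] x lex.
      by have -> : x = r by apply/injc/pair_nat_eq; rewrite cr /=; lia.
    have [->//|/parc[y xy]] := eqVneq x r.
    apply: connect_trans (IHn y _); last by move: xy; comb_lia.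
    by apply: connect1; rewrite adjc; move: xy; comb_lia.
  have adjC : connect_sym (@adj C) by apply/sym_connect_sym/adj_sym.
  by move=> x y; apply: connect_trans (to_r _ x (leqnn _)) _; rewrite adjC; apply: to_r.
apply: (acyclic_of_rank (rk := fun x => (c x).1 + (c x).2)) => x y z.
rewrite !adjc => xy xz yx zx.
by apply/injc/pair_nat_eq; move: xy xz yx zx; comb_lia.
Qed.

(** The vertices [x0], [x1], [x2] are neighbors of [(i.+1, 0)], so the maximum degree three is
    attained. Tooth vertices have degree at most two, so the spine contains all branch vertices. *)
Lemma comb_caterpillar (C : sgraph) (c : C -> nat * nat) (r x0 x1 x2 : C) i :
    injective c -> c r = (0, 0) ->
    (forall y, y != r -> exists x, comb_parent (c x) (c y)) ->
    (forall x y, adj x y = comb_adj false (c x) (c y)) ->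
    c x0 = (i, 0) -> c x1 = (i.+1, 1) -> c x2 = (i.+2, 0) ->
  is_caterpillar C.
Proof.
move=> injc cr parc adjc cx0 cx1 cx2.
have nbr_sub x (s : seq (nat * nat)) : (forall b, comb_adj false (c x) b -> b \in s) ->
    degree x <= size s.
  move=> subs; rewrite /degree cardE -(size_map c); apply: uniq_leq_size.
    by rewrite (map_inj_uniq injc) enum_uniq.
  by move=> _ /mapP[y + ->]; rewrite mem_enum inE adjc; apply: subs.
have deg3 (x : C) : degree x <= 3.
  apply: leq_trans (nbr_sub x [:: ((c x).1, (c x).2.+1);
    if (c x).2 is j.+1 then ((c x).1, j) else ((c x).1.-1, 0); ((c x).1.+1, 0)] _) _ => // b.
  rewrite !inE; case: (c x) b => [k [|j]] [k' j'] /=; rewrite !xpair_eqE; comb_lia.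
have deg2 x : branch_vertex x -> (c x).2 = 0.
  rewrite /branch_vertex; case cx: (c x) => [k [|j]] // gt2.
  suff: degree x <= 2 by rewrite leqNgt gt2.
  apply: leq_trans (nbr_sub x [:: (k, j); (k, j.+2)] _) _ => // -[k' j'].
  by rewrite cx !inE !xpair_eqE; comb_lia.
split; first exact: (comb_tree injc cr).
  apply/eqP; rewrite eqn_leq; apply/andP; split; first by apply/bigmax_leqP.
  (* The branch vertex is recovered as the parent of [x1]. *)
  have [] : exists x, c x = (i.+1, 0).
    have [|x] := parc x1; first by apply/eqP=> ex; move: cx1; rewrite ex cr.
    rewrite cx1 => xx1; exists x; apply: pair_nat_eq; move: xx1; comb_lia.
  move=> x cx; apply: leq_trans (leq_bigmax x); rewrite /degree.
  have sub : [set x0; x1; x2] \subset nbhd x.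
    apply/subsetP=> y; rewrite !inE => /orP[/orP[]|] /eqP->; rewrite adjc cx ?cx0 ?cx1 ?cx2;
    comb_lia.
  apply: leq_trans (subset_leq_card sub).
  have neq y z : c y != c z -> y != z by apply: contraNneq => ->.
  by rewrite -setUA cardsU1 cards2 !inE !negb_or !neq ?cx0 ?cx1 ?cx2 ?xpair_eqE //; lia.
exists [set x | (c x).2 == 0]; split; last by move=> x /deg2; rewrite inE => ->.
apply: (path_of_code (c := fun x => (c x).1)).
- by apply/card_gt0P; exists r; rewrite inE cr.
- move=> x y; rewrite !inE => /eqP x2' /eqP y2' exy.
  by apply/injc/pair_nat_eq; rewrite ?x2'.
- move=> x k; rewrite inE => /eqP x20 xk.
  have [|y yx] := parc x; first by apply/eqP=> ex; move: xk; rewrite ex cr.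
  exists y; move: yx; rewrite ?inE /comb_parent ?xk x20; lia.
- by move=> x y; rewrite !inE adjc; comb_lia.
Qed.

Section LineOfComb.

Variables (H : sgraph) (c : H -> nat * nat) (r x0 x1 : H) (i : nat).
Hypothesis injc : injective c.
Hypothesis cr : c r = (0, 0).
Hypothesis parc : forall y, y != r -> exists x, comb_parent (c x) (c y).
Hypothesis adjc : forall x y, adj x y = comb_adj true (c x) (c y).
Hypothesis cx0 : c x0 = (i.+1, 0).
Hypothesis cx1 : c x1 = (i, 1).

(** Shifting the spine by one frees [(0, 0)] for a new root [None]; a vertex [x] of [H] then stands
    for the edge from [Some x] to its parent. *)
Let code (u : option H) : nat * nat :=
  if u is Some x then ((c x).1.+1, (c x).2) else (0, 0).

Let root_adj : rel (option H) := fun u v => comb_adj false (code u) (code v).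

Fact root_sym : symmetric root_adj.
Proof. by move=> u v; apply: comb_adj_sym. Qed.
Fact root_irr : irreflexive root_adj.
Proof. by move=> u; apply: comb_adj_irr. Qed.
Let C : sgraph := SGraph root_sym root_irr.

Let inj_code : injective code.
Proof.
move=> [x|] [y|] //= [exy1 exy2].
by congr Some; apply/injc/pair_nat_eq.
Qed.

Let par_code (x : H) : exists u : C, comb_parent (code u) (code (Some x)).
Proof.
have [->|/parc[y yx]] := eqVneq x r; first by exists None; rewrite /= cr.
by exists (Some y); move: yx; comb_lia.
Qed.

Lemma line_of_comb_caterpillar : is_caterpillar C.
Proof.
have [|y yx1] := parc (y := x1); first by apply/eqP=> ex; move: cx1; rewrite ex cr.
(* In [C] the tooth [Some x1] hangs at [Some y], coded [(i.+1, 0)], and [u] is the spine vertex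
   before it. *)
have cy : c y = (i, 0) by apply: pair_nat_eq; move: yx1; rewrite cx1; comb_lia.
have [u uy] := par_code y.
have cu : code u = (i, 0) by apply: pair_nat_eq; move: uy; rewrite /= cy; comb_lia.
apply: (@comb_caterpillar C code None u (Some x1) (Some x0) i) => //=.
- by move=> [x|//] _; apply: par_code.
- by rewrite cx1.
- by rewrite cx0.
Qed.

(** Every edge of the tree [C] has a unique lower end, so sending [x] to the edge between [Some x]
    and its parent is a bijection. Two distinct such edges meet when one hangs below the other or
    when they share the parent, which is the sibling case. *)
Lemma comb_line_graph : is_line_graph_of_caterpillar H.
Proof.
exists C; split; first exact: line_of_comb_caterpillar.
have [p pP] := fin_all_exists par_code.
have pE u x : (p x == u) = comb_parent (code u) (code (Some x)).
  apply/eqP/idP=> [<- //|ux]; apply/inj_code/pair_nat_eq; move: (pP x) ux; comb_lia.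
have edge_p (x : H) : is_edge (G := C) [set Some x; p x].
  apply/existsP; exists (Some x); apply/existsP; exists (p x).
  by rewrite eqxx andbT /= /root_adj; move: (pP x); comb_lia.
pose f (x : H) : line_graph C := exist _ [set Some x; p x] (edge_p x).
have injf : injective f.
  move=> x y [/setP exy]; have := exy (Some x); rewrite !inE eqxx /= => /esym/orP[/eqP[]//|].
  rewrite eq_sym pE => xy; have := exy (Some y); rewrite !inE eqxx /= => /orP[/eqP[]//|].
  by rewrite eq_sym pE; move: xy; comb_lia.
have surf e : exists x, f x = e.
  case: e => e0 He; have /existsP[u /existsP[v /andP[uv /eqP eE]]] := He.
  wlog {uv} uv : u v eE / comb_parent (code u) (code v).
    move=> IH; case/or3P: (uv) => // [|vu]; first exact: IH.
    by apply: (IH v u) => //; rewrite setUC.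
  case: v uv eE => [y|] uv eE; last by move: uv; comb_lia.
  by exists y; apply/val_inj; move: uv; rewrite -pE /= => /eqP->; rewrite [LHS]setUC [RHS]eE.
exists f; split.
  apply: inj_card_bij => //; rewrite -(card_codom injf).
  by apply/subset_leq_card/subsetP=> e _; have [x <-] := surf e; apply: codom_f.
move=> x y; rewrite /= /line_adj (inj_eq injf) adjc.
have [->|nxy] := eqVneq x y; first by rewrite comb_adj_irr.
have -> : val (f x) :&: val (f y) != set0 =
    [|| p y == Some x, p x == Some y | p x == p y].
  apply/set0Pn/idP=> [[u]|].
    rewrite !inE => /andP[/orP[]/eqP-> /orP[]]; rewrite ?(inj_eq Some_inj) => /eqP.
    - by move=> exy; rewrite exy eqxx in nxy.
    - by move=> <-; rewrite eqxx.
    - by move=> ->; rewrite eqxx orbT.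
    - by move=> ->; rewrite eqxx !orbT.
  case/or3P=> /eqP e; [exists (Some x)|exists (Some y)|exists (p x)];
    by rewrite !inE ?e eqxx ?orbT.
rewrite [in p x == p y]eq_sym !pE.
have := pP x; have : c x != c y by rewrite (inj_eq injc).
have codeS z : code (Some z) = ((c z).1.+1, (c z).2) by [].
rewrite !codeS; case: (c x) (c y) (code (p x)) => [a1 a2] [b1 b2] [e1 e2].
rewrite xpair_eqE => nab.
case/orP=> /= [/andP[/eqP<- /eqP a20]|/and3P[/eqP[<-] /eqP-> /eqP a20]]; subst a2;
  first by comb_lia.
by comb_lia.
Qed.

End LineOfComb.

(** Simpliciality in the subgraph induced by [B], stated on [G] itself to avoid the subtype. *)
Definition locally_simplicial (G : sgraph) (B : {set G}) (x : G) : Prop :=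
  forall y z, y \in B -> z \in B -> adj x y -> adj x z -> y != z -> adj y z.

Lemma simplicials_induced (G : sgraph) (B Z : {set G}) :
    Z \subset B -> {in B, forall x, x \in Z <-> locally_simplicial B x} ->
  [set val x | x in simplicials (induced B)] = Z.
Proof.
move=> sZB ZP; apply/setP=> x; apply/imsetP/idP=> [[u us ->]|Zx].
  apply/(ZP _ (valP u)) => y z By Bz uy uz nyz; move: us; rewrite inE.
  move/forall_inP/(_ (exist _ y By)); rewrite inE => /(_ uy)/forall_inP.
  by move=> /(_ (exist _ z Bz)); rewrite inE => /(_ uz)/implyP; apply.
have Bx := subsetP sZB _ Zx; exists (exist _ x Bx) => //.
rewrite inE; apply/forall_inP=> y; rewrite inE => xy; apply/forall_inP=> z.
rewrite inE => xz; apply/implyP=> nyz.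
by apply: (proj1 (ZP _ Bx) Zx (val y) (val z)) => //; [apply: (valP y)|apply: (valP z)].
Qed.

(** A non-root vertex with a child also has a parent, and these two are not adjacent. A childless
    vertex sees only its parent and, if [l] holds, a sibling adjacent to that parent. The root sees
    at most [(1, 0)] and [(0, 1)]: these are adjacent if [l] holds, and otherwise the second is
    excluded. *)
Lemma comb_simplicial (G : sgraph) (B : {set G}) (c : G -> nat * nat) l (r x : G) :
    {in B &, injective c} -> c r = (0, 0) -> r \in B ->
    (forall y, y \in B -> y != r -> exists2 x, x \in B & comb_parent (c x) (c y)) ->
    {in B &, forall x y, adj x y = comb_adj l (c x) (c y)} ->
    (~~ l -> forall y, y \in B -> c y != (0, 1)) -> x \in B ->
  locally_simplicial B x <-> x = r \/ {in B, forall y, ~~ comb_parent (c x) (c y)}.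
Proof.
move=> injc cr Br parc adjc no01 Bx; split=> [simx|].
  have [->|nxr] := eqVneq x r; [by left|right=> y By; apply/negP=> xy].
  have [z Bz zx] := parc x Bx nxr.
  have xz : adj x z by rewrite adjc //; move: zx; comb_lia.
  have xy' : adj x y by rewrite adjc //; move: xy; comb_lia.
  have nzy : z != y by apply: contraTneq xy => <-; move: zx; comb_lia.
  by have := simx z y Bz By xz xy' nzy; rewrite adjc //; move: xy zx; comb_lia.
have nbr_leaf y : y \in B -> adj x y -> {in B, forall y, ~~ comb_parent (c x) (c y)} ->
    comb_parent (c y) (c x) || l && (comb_sibling (c x) (c y) || comb_sibling (c y) (c x)).
  by move=> By; rewrite adjc // => + /(_ y By)/negbTE; rewrite /comb_adj => /[swap] ->.
move=> leafx y z By Bz xy xz nyz; rewrite adjc //.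
have: c y != c z by apply: contra nyz => /eqP/injc->.
case: leafx => [xr|leafx].
  have nbr_root u : u \in B -> adj x u -> c u = (1, 0) \/ l /\ c u = (0, 1).
    move=> Bu; rewrite adjc // xr cr => ru; have: (c u == (1, 0)) || (c u == (0, 1)).
      by move: ru; case: (c u) => u1 u2; rewrite !xpair_eqE; comb_lia.
    case/orP=> /eqP cu; [by left|right; split=> //].
    by case: (boolP l) => // /no01/(_ u Bu); rewrite cu.
  by case: (nbr_root y By xy) => [|[lT]] ->; case: (nbr_root z Bz xz) => [|[lT']] -> //;
    rewrite ?lT ?lT'.
move: (nbr_leaf y By xy leafx) (nbr_leaf z Bz xz leafx).
case: (c x) (c y) (c z) => [d1 d2] [a1 a2] [b1 b2]; rewrite xpair_eqE.
case/orP=> [py|/andP[lT py]] /orP[pz|/andP[lT' pz]]; move: py pz.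
- by comb_lia.
- by rewrite lT'; comb_lia.
- by rewrite lT; comb_lia.
- by comb_lia.
Qed.

(** * Subdivided stars *)

Section SubdividedStar.

Variables (G : sgraph) (d : G -> nat) (leg : G -> G) (v : G).

(** The level [d] and the label [leg] act as polar coordinates. The center belongs to all legs, so
    its label is ignored. *)
Definition spider_parent (x y : G) : bool :=
  (d y == (d x).+1) && ((d x == 0) || (leg x == leg y)).

Definition spider (B : {set G}) : Prop :=
  [/\ v \in B, d v = 0,
      {in B &, forall x y, d x = d y -> (d x == 0) || (leg x == leg y) -> x = y},
      {in B, forall y, 0 < d y -> exists2 x, x \in B & spider_parent x y} &
      {in B &, forall x y, adj x y = spider_parent x y || spider_parent y x}].

Lemma spider_star (B : {set G}) :
    spider B -> {in B, forall x, d x <= 1} ->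
  iso (induced B) (star #|[set x in B | d x == 1]|).
Proof.
move=> [Bv dv injd _ adjd] led; set L := [set x in B | d x == 1].
have enumL x : x \in B -> d x != 0 -> x \in enum L.
  by move=> Bx dx; rewrite mem_enum inE Bx eqn_leq led //= lt0n.
pose f (x : induced B) : star #|L| :=
  if d (val x) == 0 then None else insub (index (val x) (enum L)).
have isf x : isSome (f x) = (d (val x) != 0).
  rewrite /f; case: eqVneq => // dx; rewrite insubT ?cardE ?index_mem ?enumL //.
  exact: valP.
exists f; split=> [|x y].
  apply: inj_card_bij => [x y exy|].
    have := isf x; rewrite exy isf; move: exy; rewrite /f.
    case: eqVneq => [dx|dx]; case: eqVneq => // dy.
      move=> _ _; apply/val_inj/injd; rewrite ?dx ?dy ?eqxx //; exact: valP.
    have [Lx Ly] : val x \in enum L /\ val y \in enum L.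
      by split; apply: enumL => //; apply: valP.
    rewrite !insubT ?cardE ?index_mem // => lx ly [exy] _.
    by apply/val_inj; rewrite -(nth_index v Lx) exy nth_index.
  rewrite card_option card_ord card_sig -add1n.
  have -> : #|B| = #|v |: L|.
    apply: eq_card => x; rewrite !inE; case: (boolP (x \in B)) => [Bx|nBx].
      have [dx|dx] := eqVneq (d x) 0; first by rewrite (injd x v) ?dx ?dv ?eqxx.
      by rewrite eqn_leq led // lt0n dx orbT.
    by rewrite orbF; apply/esym; apply: contraNF nBx => /eqP->.
  by rewrite cardsU1 inE dv andbF.
rewrite /= /star_adj !isf /induced_adj adjd; try exact: valP.
move: (led _ (valP x)) (led _ (valP y)); rewrite /spider_parent /=.
by case: (d _) => [|[]] //; case: (d _) => [|[]] //.
Qed.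

(** Induction on [#|B|]. Let [u] have maximal level, at least two. Its parent [y] has exactly two
    neighbors, [u] and its own parent [x], so [B] arises from [B :\ u] by subdividing the edge
    [xy]. *)
Lemma spider_subdivision (B : {set G}) :
  spider B -> subdivision (star #|[set x in B | d x == 1]|) (induced B).
Proof.
move defn: #|B| => n; elim: n B defn => [|n IHn] B cardB spB.
  by move: cardB; case: spB => Bv _ _ _ _; rewrite (cardD1 v) Bv.
have [/forall_inP led|] := boolP [forall x in B, d x <= 1].
  by apply: subdivision_iso; apply: spider_star.
rewrite negb_forall_in => /exists_inP[u0 Bu0]; rewrite -ltnNge => du0.
have [Bv dv injd pard adjd] := spB.
have [u Bu maxu] : exists2 u, u \in B & {in B, forall y, d y <= d u}.
  by exists [arg max_(u > u0 in B) d u]; case: arg_maxnP.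
have du : 1 < d u by apply: leq_trans (maxu _ Bu0).
have [y By yu] := pard u Bu (ltnW du).
have dy : 0 < d y by move: yu du; rewrite /spider_parent; lia.
have [x Bx xy] := pard y By dy.
have par_uniq z z' w : z \in B -> z' \in B ->
    spider_parent z w -> spider_parent z' w -> z = z'.
  move=> Bz Bz' /andP[/eqP dz lz] /andP[/eqP dz' lz'].
  have ed : d z = d z' by lia.
  apply: injd => //; case: eqP lz lz' => //= nz /eqP->; rewrite -ed.
  by case: eqP => //= _; rewrite eq_sym.
have chi_uniq z z' w : z \in B -> z' \in B -> 0 < d w ->
    spider_parent w z -> spider_parent w z' -> z = z'.
  move=> Bz Bz' dw /andP[/eqP dz +] /andP[/eqP dz' +].
  by rewrite eqn0Ngt dw /= => /eqP lz /eqP lz'; apply: injd; rewrite ?dz // -lz lz' eqxx orbT.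
have ay z : z \in B -> adj y z = (z == x) || (z == u).
  move=> Bz; rewrite adjd // orbC; congr orb; apply/idP/eqP => [zy|->//].
    exact: par_uniq zy xy.
  exact: chi_uniq zy yu.
have au z : z \in B -> adj u z = (z == y).
  move=> Bz; rewrite adjd //; case: eqP => [->|nzy]; first by rewrite yu orbT.
  have -> : spider_parent u z = false.
    by have := maxu z Bz; rewrite /spider_parent; lia.
  apply/negbTE/negP=> zu; case: nzy; exact: par_uniq zu yu.
pose B' := B :\ u.
have [neq_yu neq_xu] : y != u /\ x != u.
  by split; apply/eqP=> e; move: yu xy; rewrite e /spider_parent; lia.
have neq_xy : x != y by apply/eqP=> e; move: xy; rewrite e /spider_parent; lia.
have B'y : y \in B' by rewrite !inE neq_yu.
have B'x : x \in B' by rewrite !inE neq_xu.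
have sB z : z \in B' -> z \in B by rewrite !inE => /andP[].
have spB' : spider B'.
  split=> //.
  - by rewrite !inE Bv andbT; apply: contraTneq du => <-; rewrite dv.
  - by move=> a b /sB Ba /sB Bb; apply: injd.
  - move=> a Ba da; have [b Bb ba] := pard a (sB _ Ba) da.
    exists b => //; rewrite !inE Bb andbT; apply: contraTneq ba => ->.
    by rewrite /spider_parent ltn_eqF // ltnS maxu // sB.
  - by move=> a b /sB Ba /sB Bb; apply: adjd.
have cardB' : #|B'| = n by move: cardB; rewrite (cardsD1 u) Bu => -[].
have <- : #|[set x in B' | d x == 1]| = #|[set x in B | d x == 1]|.
  by apply: eq_card => z; rewrite !inE; case: (eqVneq z u) => //= ->; rewrite Bu gtn_eqF.
pose x' : induced B' := exist _ x B'x; pose y' : induced B' := exist _ y B'y.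
apply: (subdivision_step (x := x') (y := y') (IHn _ cardB' spB')).
  by rewrite /= /induced_adj /= adj_sym ay ?eqxx.
(* In the subdivision, [y] becomes the new vertex and [u] takes the former place of [y]. *)
pose f (z : induced B) : subdivide_edge x' y' :=
  if val z == y then None else insub (if val z == u then y else val z).
have fE (z : induced B) : val z != y ->
    exists2 t : induced B', f z = Some t & val t = if val z == u then y else val z.
  move=> nzy; have Bt : (if val z == u then y else val z) \in B'.
    by case: (eqVneq (val z) u) => // nzu; rewrite !inE nzu; apply: (valP z).
  by exists (exist (fun t => t \in B') _ Bt) => //; rewrite /f (negbTE nzy) insubT.
have fy (z : induced B) : val z = y -> f z = None by rewrite /f => ->; rewrite eqxx.
exists f; split.
  apply: inj_card_bij => [z w|]; last by rewrite card_option !card_sig cardB cardB'.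
  move=> e; apply: val_inj; move: e.
  have [zy|nzy] := eqVneq (val z) y; have [wy|nwy] := eqVneq (val w) y.
  - by rewrite zy wy.
  - by have [t -> _] := fE _ nwy; rewrite fy.
  - by have [t -> _] := fE _ nzy; rewrite fy.
  have [t -> tz] := fE _ nzy; have [s -> sw] := fE _ nwy => -[ets].
  move: tz; rewrite ets sw; case: eqVneq => [->|nwu]; case: eqVneq => [->|nzu] // e.
    by rewrite e eqxx in nzy.
  by rewrite e eqxx in nwy.
have setxy (a b : induced B') : a != y' -> b != y' -> [set a; b] != [set x'; y'].
  move=> ay' by'; apply/negP=> /eqP/setP/(_ y').
  by rewrite !inE eqxx orbT ![y' == _]eq_sym (negbTE ay') (negbTE by').
(* Every pair of distinct vertices fits this pattern, possibly after a swap, since [y] and [u]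
   differ. *)
have main (z w : induced B) : val z != y -> val w != u -> adj (f z) (f w) = adj z w.
  move=> nzy nwu; have [t -> tz] := fE _ nzy.
  have [Bz Bw] := (valP z, valP w).
  have [wy|nwy] := eqVneq (val w) y.
    rewrite fy // /= !inE -!val_eqE /= tz /induced_adj /= wy adj_sym ay //.
    by case: (eqVneq (val z) u) => [->|nzu]; rewrite ?eqxx ?orbT // (negbTE nzy).
  have [s -> sw] := fE _ nwy; rewrite /= /induced_adj /= tz sw (negbTE nwu).
  have ns : s != y' by rewrite -val_eqE /= sw (negbTE nwu).
  have [zu|nzu] := eqVneq (val z) u.
    rewrite zu au // ay // (negbTE nwu) orbF (negbTE nwy).
    case: eqVneq => //= wx; apply/negbTE; rewrite negbK; apply/eqP.
    have -> : t = y' by apply: val_inj; rewrite /= tz zu eqxx.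
    have -> : s = x' by apply: val_inj; rewrite /= sw (negbTE nwu).
    by rewrite setUC.
  by rewrite setxy ?andbT // -val_eqE /= tz (negbTE nzu).
move=> z w; have [zy|nzy] := eqVneq (val z) y; last first.
  have [wu|nwu] := eqVneq (val w) u; last exact: main.
  have [zu|nzu] := eqVneq (val z) u.
    by have -> : z = w by [apply: val_inj; rewrite zu wu]; rewrite !adj_irr.
  by rewrite adj_sym [RHS]adj_sym main // wu eq_sym.
have [wy|nwy] := eqVneq (val w) y.
  by have -> : z = w by [apply: val_inj; rewrite zy wy]; rewrite !adj_irr.
by rewrite adj_sym [RHS]adj_sym main // zy.
Qed.

End SubdividedStar.

(** * Breadth-first trees and hairs *)

Definition adj_in (G : sgraph) (B : {set G}) : rel G :=
  fun x y => [&& x \in B, y \in B & adj x y].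

Definition connected_in (G : sgraph) (B : {set G}) : Prop :=
  {in B &, forall x y, connect (adj_in B) x y}.

Lemma connect_adj_in_sym (G : sgraph) (B : {set G}) : connect_sym (adj_in B).
Proof. by apply: sym_connect_sym => x y; rewrite /adj_in andbCA adj_sym. Qed.

Lemma connected_induced (G : sgraph) (B : {set G}) :
  connected_graph (induced B) -> connected_in B.
Proof.
move=> [_ conB] x y Bx By; have /connectP[p] := conB (exist _ x Bx) (exist _ y By).
move=> pp ely; apply/connectP; exists (map val p); last first.
  by rewrite (last_map val p (exist _ x Bx)) -ely.
rewrite -[x in path _ x]/(val (exist (fun z => z \in B) x Bx)).
elim: p (exist _ x Bx) pp {ely} => //= t p IHp z /andP[zt pp].
by rewrite [X in X && _]/adj_in (valP z) (valP t) [adj _ _]zt; apply: IHp.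
Qed.

(** The clauses force [d] to be the distance from [r] within [A]: parents bound the distance above,
    and the last clause bounds it below. Nothing is required outside [A]. *)
Definition bfs_tree (G : sgraph) (A : {set G}) (r : G) (d : G -> nat) (par : G -> G) : Prop :=
  [/\ r \in A, d r = 0,
      {in A, forall x, x != r -> [/\ par x \in A, adj (par x) x & d x = (d (par x)).+1]} &
      {in A &, forall x y, adj x y -> d x <= (d y).+1}].

Lemma bfs_tree_exists (G : sgraph) (A : {set G}) r :
  connected_in A -> r \in A -> exists d, exists par, bfs_tree A r d par.
Proof.
move=> conA Ar.
pose walk k x := [exists t : k.-tuple G, path (adj_in A) r t && (last r t == x)].
(* Outside [A] the default 0 satisfies the lower bound trivially. *)
have distP x : exists k, (x \in A -> walk k x) /\ (forall j, walk j x -> k <= j).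
  have [Ax|nAx] := boolP (x \in A); last by exists 0; split.
  have ex : exists k, walk k x.
    have /connectP[p pp lp] := conA r x Ar Ax; exists (size p).
    by apply/existsP; exists (in_tuple p); rewrite pp lp eqxx.
  by exists (ex_minn ex); case: ex_minnP.
have {distP}[d dP] := fin_all_exists distP.
have [d_walk d_min] : {in A, forall x, walk (d x) x} /\ (forall x j, walk j x -> d x <= j).
  by split=> x; case: (dP x) => // + _.
have walkS k x y : walk k x -> x \in A -> y \in A -> adj x y -> walk k.+1 y.
  case/existsP=> t /andP[pt /eqP lt] Ax Ay xy; apply/existsP; exists [tuple of rcons t y].
  by rewrite /= rcons_path pt last_rcons eqxx lt /adj_in Ax Ay xy.
have dr : d r = 0.
  apply/eqP; rewrite -leqn0; apply: d_min; apply/existsP; exists [tuple].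
  by rewrite /= eqxx.
have parP x : exists y, x \in A -> x != r -> [/\ y \in A, adj y x & d x = (d y).+1].
  have [Ax|nAx] := boolP (x \in A); last by exists x.
  have [->|nxr] := eqVneq x r; first by exists r.
  have /existsP[t /andP[]] := d_walk x Ax.
  case/lastP: {t}(val t) (size_tuple t) => [_ _ /eqP lr|p y].
    by rewrite -lr eqxx in nxr.
  rewrite size_rcons rcons_path last_rcons => szp /andP[pp ly] /eqP ey; subst y.
  case/and3P: ly => Al _ lx; exists (last r p) => _ _; split=> //.
  have wl : walk (size p) (last r p).
    by apply/existsP; exists (in_tuple p); rewrite pp eqxx.
  apply/eqP; rewrite eqn_leq; apply/andP; split; last by rewrite -szp ltnS d_min.
  by apply: d_min; apply: walkS (d_walk _ Al) _ _ _.
have {parP}[par parP] := fin_all_exists parP.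
exists d, par; split=> // x y Ax Ay xy.
by apply: d_min; apply: walkS (d_walk _ Ay) _ _ _; rewrite // adj_sym.
Qed.

Section BfsTree.

Variables (G : sgraph) (A : {set G}) (r : G) (d : G -> nat) (par : G -> G).
Hypothesis bfsA : bfs_tree A r d par.

Definition child (x y : G) : bool := [&& y \in A, y != r & par y == x].

Definition childless (x : G) : bool := [forall y, ~~ child x y].

Definition cut_off (w : G) : {set G} :=
  [set y in A :\ w | ~~ connect (adj_in (A :\ w)) y r].

Lemma child_prop x y : child x y ->
  [/\ x \in A, y \in A, adj x y & d y = (d x).+1].
Proof.
have [_ _ parP _] := bfsA; case/and3P=> Ay nyr /eqP <-.
by have [? ? ?] := parP y Ay nyr.
Qed.

Lemma par_child x : x \in A -> x != r -> child (par x) x.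
Proof. by move=> Ax nxr; rewrite /child Ax nxr eqxx. Qed.

Lemma bfs_adj x y : x \in A -> y \in A -> adj x y -> d x <= (d y).+1 /\ d y <= (d x).+1.
Proof.
have [_ _ _ dP] := bfsA; move=> Ax Ay xy; split; first exact: dP.
by apply: dP; rewrite // adj_sym.
Qed.

(** Climbing from any other vertex never passes through [x], since the vertex before it would be a
    child of [x]. *)
Lemma childless_noncut x : childless x -> connected_in (A :\ x).
Proof.
move=> /forallP leafx.
suff to_r n y : d y <= n -> y \in A :\ x -> x != r /\ connect (adj_in (A :\ x)) y r.
  move=> y z Ay Az; have [_ yr] := to_r _ y (leqnn _) Ay.
  have [_ zr] := to_r _ z (leqnn _) Az; apply: connect_trans yr _.
  by rewrite connect_adj_in_sym.
elim: n y => [|n IHn] y dy Ay.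
all: have /setD1P[nyx Ay'] := Ay.
all: have [er|nyr] := eqVneq y r; first by rewrite er eq_sym in nyx *.
all: have [Ap _ yp dp] := child_prop (par_child Ay' nyr).
  by rewrite dp in dy.
have Ap' : par y \in A :\ x.
  rewrite !inE Ap andbT; apply/eqP=> e.
  by have := leafx y; rewrite -e par_child.
have [|nxr pr] := IHn _ _ Ap'; first by rewrite -ltnS -dp.
split=> //; apply: connect_trans pr; apply: connect1.
by rewrite /adj_in Ay Ap' adj_sym.
Qed.

Lemma cut_off_adj w y z :
  y \in cut_off w -> z \in A -> z != w -> adj y z -> z \in cut_off w.
Proof.
rewrite !inE => /andP[/andP[nyw Ay] nyr] Az nzw yz; rewrite nzw Az /=.
apply: contra nyr; apply: connect_trans; apply: connect1.
by rewrite /adj_in !inE nyw nzw Ay Az.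
Qed.

Lemma cut_off_sub w y : y \in cut_off w -> [/\ y \in A, y != w & y != r].
Proof.
rewrite !inE => /andP[/andP[nyw Ay] nyr]; split=> //.
by apply: contraNneq nyr => ->.
Qed.

(** Since [w] is a cut vertex, something is cut off by it. Climbing from there to the root can leave
    the cut-off part only through [w], hence passes a cut-off child of [w]. *)
Lemma cut_off_child w : w \in A -> w != r -> ~ connected_in (A :\ w) ->
  exists2 c, child w c & c \in cut_off w.
Proof.
move=> Aw nwr cutw; have [Ar _ _ _] := bfsA.
have [D0|] := eqVneq (cut_off w) set0.
  case: cutw; have to_r y : y \in A :\ w -> connect (adj_in (A :\ w)) y r.
    by move=> Ay; have /setP/(_ y) := D0; rewrite inE Ay inE /= => /negbFE.
  move=> y z /to_r yr /to_r zr; apply: connect_trans yr _.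
  by rewrite connect_adj_in_sym.
case/set0Pn=> y Dy; move: {2}(d y) (leqnn (d y)) => n.
elim: n y Dy => [|n IHn] y Dy dy; have [Ay nyw nyr] := cut_off_sub Dy;
  have [Ap _ yp dp] := child_prop (par_child Ay nyr); first by rewrite dp in dy.
have [e|npw] := eqVneq (par y) w; first by exists y; rewrite // -e par_child.
apply: (IHn (par y)); last by rewrite -ltnS -dp.
by apply: cut_off_adj Dy _ _ _; rewrite // adj_sym.
Qed.

Lemma tree_path_prop x q : x \in A -> path child x q ->
  [/\ {in x :: q, forall y, [/\ y \in A, d x <= d y & d y <= d (last x q)]},
      {in x :: q &, injective d},
      {in q, forall y, par y \in x :: q /\ y != r} &
      {in x :: q, forall y, y != last x q -> exists2 z, z \in q & child y z}].
Proof.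
elim: q x => [|c q IHq] x Ax /=.
  by move=> _; split=> // [y|y z|y]; rewrite !inE => /eqP-> //;
    [move=> /eqP->|rewrite eqxx].
case/andP=> xc /(IHq _ _)[]; first by have [] := child_prop xc.
have [_ Ac axc dc] := child_prop xc.
move=> memq injq parq chiq.
have ltq y : y \in c :: q -> d x < d y by move=> /memq[_ + _]; rewrite dc.
split.
- move=> y; rewrite inE => /orP[/eqP->|/memq[Ay le1 le2]]; last by split=> //; lia.
  by split=> //; have [_ _] := memq c (mem_head _ _); lia.
- move=> y z; rewrite !(in_cons x) => /predU1P[->|yq] /predU1P[->|zq] //.
  + by move=> e; have := ltq z zq; rewrite e ltnn.
  + by move=> e; have := ltq y yq; rewrite e ltnn.
  + exact: injq.
- move=> y; rewrite inE => /orP[/eqP->|/parq[py nyr]].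
    by case/and3P: xc => _ -> /eqP->; rewrite mem_head.
  by rewrite inE py orbT.
- move=> y; rewrite (in_cons x) => /predU1P[-> _|/chiq yq /yq[z zq yz]].
    by exists c => //; rewrite mem_head.
  by exists z => //; rewrite inE zq orbT.
Qed.

(** Descending tree paths are geodesic and hence induced: adjacent vertices differ by at most one
    level, and the levels on the path are distinct. *)
Lemma tree_path_adj x q : x \in A -> path child x q ->
  {in x :: q &, forall y z, adj y z = ((d y).+1 == d z) || ((d z).+1 == d y)}.
Proof.
move=> Ax pq; have [memq injq parq chiq] := tree_path_prop Ax pq.
have chi y z : y \in x :: q -> z \in x :: q -> (d y).+1 = d z -> adj y z.
  move=> qy qz dyz; have [Ay lexy _] := memq y qy.
  move: (qz); rewrite inE => /predU1P[ez|qz'].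
    by move: lexy; rewrite -ez -dyz ltnn.
  have [qp nzr] := parq z qz'; have [Az _ _] := memq z qz.
  have [_ _ apz dp] := child_prop (par_child Az nzr).
  suff -> : y = par z by [].
  by apply: injq => //; apply: succn_inj; rewrite dyz.
move=> y z qy qz; apply/idP/orP=> [yz|[]/eqP].
- have [Ay _ _] := memq y qy; have [Az _ _] := memq z qz.
  have [le1 le2] := bfs_adj Ay Az yz.
  suff: d y != d z by lia.
  by apply: contraTneq yz => /injq-> //; rewrite adj_irr.
- exact: chi.
- by rewrite adj_sym; apply: chi.
Qed.

Lemma descend x : x \in A -> exists2 q, path child x q & childless (last x q).
Proof.
move: {2}(\max_y d y - d x) (leqnn (\max_y d y - d x)) => n.
elim: n x => [|n IHn] x len Ax.
all: have [lx|] := boolP (childless x); first by exists [::].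
all: rewrite negb_forall => /existsP[c]; rewrite negbK => xc.
all: have [_ Ac _ dc] := child_prop xc; have := leq_bigmax (F := d) c; rewrite dc => lec.
  by move: len lec; lia.
have [|//|q pq lq] := IHn c; first by move: len lec; rewrite dc; lia.
by exists (c :: q); rewrite //= xc.
Qed.

Lemma tree_path_cut_off w x q y : x \in A -> path child x q ->
    {in x :: q, forall z, z != w} -> y \in x :: q -> y \in cut_off w ->
  x \in cut_off w.
Proof.
elim: q x => [|c q IHq] x Ax /=; first by rewrite inE => _ _ /eqP->.
move=> /andP[xc pq] neqw; rewrite inE => /predU1P[->//|qy] Dy.
have [_ Ac axc _] := child_prop xc.
apply: (@cut_off_adj w c) => //; [|by rewrite neqw ?mem_head|by rewrite adj_sym].
by apply: IHq => // z qz; apply: neqw; rewrite inE qz orbT.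
Qed.

Variable X : {set G}.
Hypothesis noncutX : {in A, forall x, connected_in (A :\ x) -> x \in X}.

(** The list [q] omits the root [w] of the hair; it is empty when the hair is [w] alone, which then
    lies in [X]. *)
Definition hair (w : G) (q : seq G) : Prop :=
  [/\ path child w q, {in q, forall y, y \in cut_off w} & last w q \in X].

(** If [w] is not in [X], it is a cut vertex. From a cut-off child, a descent to a childless vertex
    never meets [w] again, as levels increase, so it stays cut off; a childless vertex is not a cut
    vertex and thus lies in [X]. *)
Lemma hair_exists w : w \in A -> w != r -> exists q, hair w q.
Proof.
move=> Aw nwr; have [Xw|nXw] := boolP (w \in X); first by exists [::].
have [|c wc Dc] := cut_off_child Aw nwr; first by move=> /(noncutX Aw); apply/negP.
have [_ Ac _ dc] := child_prop wc; have [q pq lq] := descend Ac.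
have [memq _ _ _] := tree_path_prop Ac pq.
exists (c :: q); split; first by rewrite /= wc.
  have: forall y, y \in c :: q -> y != w.
    by move=> y /memq[_ + _]; apply: contraTneq => ->; rewrite dc ltnn.
  elim: q c {wc dc lq memq Ac} pq Dc => [|c' q IHq] c /=.
    by move=> _ Dc _ y; rewrite inE => /eqP->.
  case/andP=> cc' pq Dc neqw y; rewrite inE => /predU1P[->//|qy].
  apply: (IHq c') qy => // [|z qz]; last by apply: neqw; rewrite inE qz orbT.
  have [_ Ac' acc' _] := child_prop cc'; apply: cut_off_adj Dc Ac' _ acc'.
  by apply: neqw; rewrite !inE eqxx orbT.
have [Al _ _] := memq _ (mem_last c q).
by apply: noncutX => //; apply: childless_noncut.
Qed.

(** * Hairs hanging from a set that contains the root side *)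

Section Hairs.

Variables (K W : {set G}) (hq : G -> seq G).
Hypothesis subKA : K \subset A.
Hypothesis conK : {in W & K, forall w x, connect (adj_in (A :\ w)) x r}.
Hypothesis W_attached : {in W, forall w,
  [/\ w \in A, w \notin K & exists2 x, x \in K & adj w x]}.
Hypothesis stableW : stable W.
Hypothesis hairW : {in W, forall w, hair w (hq w)}.

Lemma cut_off_notin_K w x : w \in W -> x \in K -> x \notin cut_off w.
Proof. by move=> Ww Kx; rewrite inE conK ?andbF. Qed.

(** After [w] is deleted, [w'] still reaches the root through its neighbor in [K]. *)
Lemma cut_off_notin_W w w' : w \in W -> w' \in W -> w' \notin cut_off w.
Proof.
move=> Ww Ww'; apply/negP=> Dw'; have [Aw nKw _] := W_attached Ww.
have [_ _ [x Kx w'x]] := W_attached Ww'.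
have := cut_off_notin_K Ww Kx; rewrite (cut_off_adj Dw') //; first exact: (subsetP subKA).
by apply: contraNneq nKw => <-.
Qed.

Lemma hair_sub w y : w \in W -> y \in w :: hq w -> y \in A.
Proof.
move=> Ww; have [Aw _ _] := W_attached Ww; have [pq _ _] := hairW Ww.
by have [memq _ _ _] := tree_path_prop Aw pq; case/memq.
Qed.

Lemma hair_notin_K w y : w \in W -> y \in w :: hq w -> y \notin K.
Proof.
move=> Ww; rewrite inE => /predU1P[->|qy]; first by have [] := W_attached Ww.
have [_ Dq _] := hairW Ww.
by apply: contraTN (Dq y qy) => /(cut_off_notin_K Ww).
Qed.

Lemma hair_tail_nadj_K w y x : w \in W -> y \in hq w -> x \in K -> ~~ adj y x.
Proof.
move=> Ww qy Kx; have [_ Dq _] := hairW Ww; have [_ nKw _] := W_attached Ww.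
apply: contra (cut_off_notin_K Ww Kx) => yx; apply: cut_off_adj (Dq y qy) _ _ yx.
  exact: (subsetP subKA).
by apply: contraNneq nKw => <-.
Qed.

(** The tail at [w] lies in [cut_off w], whose neighbors in [A] other than [w] stay inside it. The
    hair at [w'] avoids [w], and its root is not cut off by [w], so the whole hair lies outside
    [cut_off w]. The roots themselves are non-adjacent because [W] is stable. *)
Lemma hairs_apart w w' y y' : w \in W -> w' \in W -> w != w' ->
  y \in w :: hq w -> y' \in w' :: hq w' -> y != y' /\ ~~ adj y y'.
Proof.
have root_tail v v' z : v \in W -> v' \in W -> v != v' -> z \in hq v' ->
    v != z /\ ~~ adj v z.
  move=> Wv Wv' nvv' qz; have [_ Dq _] := hairW Wv'; have [Av _ _] := W_attached Wv.
  have nDv := cut_off_notin_W Wv' Wv; split.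
    by apply: contraNneq nDv => ->; apply: Dq.
  by apply: contra nDv => vz; apply: cut_off_adj (Dq z qz) Av nvv' _; rewrite adj_sym.
move=> Ww Ww' nww' qy qy'; have Ay' := hair_sub Ww' qy'.
move: qy; rewrite inE => /predU1P[->|qy].
  move: qy'; rewrite inE => /predU1P[->|qy']; first by split=> //; apply: stableW.
  exact: (root_tail _ w').
move: (qy'); rewrite inE => /predU1P[->|qy''].
  rewrite eq_sym adj_sym; apply: (root_tail _ w) => //; by rewrite eq_sym.
have [_ Dq _] := hairW Ww; have [pq' Dq' _] := hairW Ww'.
have nDy' : y' \notin cut_off w.
  apply: contra (cut_off_notin_W Ww Ww').
  have nwq z : z \in w' :: hq w' -> z != w.
    rewrite inE => /predU1P[->|qz]; first by rewrite eq_sym.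
    by apply: contraNneq (cut_off_notin_W Ww' Ww) => <-; apply: Dq'.
  have [Aw' _ _] := W_attached Ww'.
  exact: tree_path_cut_off pq' nwq qy'.
split; first by apply: contraNneq nDy' => <-; apply: Dq.
apply: contra nDy' => yy'; apply: cut_off_adj (Dq y qy) Ay' _ yy'.
by apply: contraNneq (cut_off_notin_W Ww' Ww) => <-; apply: Dq'.
Qed.

End Hairs.

End BfsTree.

(** * Combs formed by a tree path and hairs *)

Section Comb.

Variables (G : sgraph) (A X : {set G}) (r : G) (d : G -> nat) (par : G -> G).
Hypothesis bfsA : bfs_tree A r d par.
Notation child := (child A r par).

Variables (p : seq G) (l : bool) (W : {set G}) (hq : G -> seq G) (pos : G -> nat).
Local Notation z := (last r p).
Hypothesis path_p : path child r p.
Hypothesis W_sub : {in W, forall w, w \in A /\ w \notin r :: p}.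
Hypothesis stableW : stable W.
Hypothesis hairW : {in W, forall w, hair A r par X w (hq w)}.
(* A tooth with root [w] is attached at the spine vertex of level [pos w], and
   also at the next one when [l] is set. *)
Hypothesis attW : {in W, forall w, {in r :: p, forall x,
  adj w x = (d x == pos w) || l && (d x == (pos w).+1)}}.
Hypothesis posW : {in W, forall w, pos w < d z /\ (~~ l -> 0 < pos w)}.
Hypothesis inj_pos : {in W &, injective pos}.

Let Ar : r \in A. Proof. by have [] := bfsA. Qed.
Let dr : d r = 0. Proof. by have [] := bfsA. Qed.
Let K : {set G} := [set x in r :: p].

Let path_prop := tree_path_prop bfsA Ar path_p.

Lemma spine_level k : k <= d z -> exists2 x, x \in r :: p & d x = k.
Proof.
have [memp _ parp chip] := path_prop.
elim: k => [_|k IHk ltk]; first by exists r; rewrite ?mem_head.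
have [x px dx] := IHk (ltnW ltk).
have [|y py xy] := chip x px; first by apply: contraTneq ltk => <-; rewrite dx ltnn.
exists y; first by rewrite inE py orbT.
by have [_ _ _ ->] := child_prop bfsA xy; rewrite dx.
Qed.

Let subKA : K \subset A.
Proof. by apply/subsetP=> x; rewrite inE => px; have [/(_ x px)[]] := path_prop. Qed.

Lemma spine_connect w x : w \notin r :: p -> x \in r :: p ->
  connect (adj_in (A :\ w)) x r.
Proof.
move=> npw; have [memp _ parp _] := path_prop.
move: {2}(d x) (leqnn (d x)) => n; elim: n x => [|n IHn] x dx px.
all: have [Ax _ _] := memp x px.
all: have [->//|nxr] := eqVneq x r.
all: have [Ay _ ayx dy] := child_prop bfsA (par_child par Ax nxr).
  by rewrite dy in dx.
have [|py _] := parp x; first by move: px; rewrite inE (negbTE nxr).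
have le_n : d (par x) <= n by rewrite -ltnS -dy.
apply: connect_trans (IHn _ le_n py); apply: connect1.
rewrite /adj_in !inE Ax Ay adj_sym ayx !andbT.
by rewrite (memPn npw _ px) (memPn npw _ py).
Qed.

Let conK : {in W & K, forall w x, connect (adj_in (A :\ w)) x r}.
Proof.
by move=> w x Ww; rewrite inE; apply: spine_connect; have [] := W_sub Ww.
Qed.

Let W_att : {in W, forall w, [/\ w \in A, w \notin K & exists2 x, x \in K & adj w x]}.
Proof.
move=> w Ww; have [Aw nKw] := W_sub Ww; rewrite inE; split=> //.
have [ltz _] := posW Ww; have [x px dx] := spine_level (ltnW ltz).
by exists x; rewrite ?inE // attW // dx eqxx.
Qed.

Let apart := hairs_apart bfsA subKA conK W_att stableW hairW.
Let tail_nadj := hair_tail_nadj_K subKA conK W_att hairW.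
Let hair_notin := hair_notin_K conK W_att hairW.

Definition comb_set : {set G} :=
  [set y | (y \in r :: p) || [exists w in W, y \in w :: hq w]].

Let root (y : G) : G := odflt r [pick w in W | y \in w :: hq w].

(** Second coordinate 0 is reserved for the spine, so a hair counts its vertices from 1 at its
    root. *)
Let code (y : G) : nat * nat :=
  if y \in r :: p then (d y, 0) else (pos (root y), (d y - d (root y)).+1).

Let B := comb_set.

Lemma comb_setP y : y \in comb_set ->
  y \in r :: p \/ exists2 w, w \in W & y \in w :: hq w.
Proof. by rewrite in_set => /orP[|/exists_inP[w]]; [left|right; exists w]. Qed.

Let B_spine y : y \in r :: p -> y \in B.
Proof. by move=> py; rewrite in_set py. Qed.

Let B_tooth w y : w \in W -> y \in w :: hq w -> y \in B.
Proof. by move=> Ww qy; rewrite in_set; apply/orP; right; apply/exists_inP; exists w. Qed.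

Let code_spine y : y \in r :: p -> code y = (d y, 0).
Proof. by rewrite /code => ->. Qed.

Let code_tooth w y : w \in W -> y \in w :: hq w -> code y = (pos w, (d y - d w).+1).
Proof.
move=> Ww qy; have := hair_notin Ww qy; rewrite in_set /code => /negbTE->.
suff -> : root y = w by [].
rewrite /root; case: pickP => [w' /andP[Ww' qy'] /=|/(_ w)]; last by rewrite Ww qy.
have [//|nww'] := eqVneq w' w.
by have [] := apart Ww' Ww nww' qy' qy; rewrite eqxx.
Qed.

Let tooth_prop w : w \in W ->
  [/\ {in w :: hq w, forall y, [/\ y \in A, d w <= d y & d y <= d (last w (hq w))]},
      {in w :: hq w &, injective d},
      {in hq w, forall y, par y \in w :: hq w /\ y != r} &
      {in w :: hq w, forall y, y != last w (hq w) -> exists2 c, c \in hq w & child y c}].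
Proof.
move=> Ww; have [Aw _] := W_sub Ww; have [pq _ _] := hairW Ww.
exact: tree_path_prop.
Qed.

Let tail_level w y : w \in W -> y \in hq w -> d w < d y.
Proof.
move=> Ww qy; have [memq _ parq _] := tooth_prop Ww.
have [qp nyr] := parq y qy; have [_ lep _] := memq _ qp.
have [|Ay _ _] := memq y; first by rewrite inE qy orbT.
by have [_ _ _ ->] := child_prop bfsA (par_child par Ay nyr).
Qed.

Lemma comb_set_sub : comb_set \subset A.
Proof.
apply/subsetP=> y /comb_setP[py|[w Ww qy]].
  by apply: (subsetP subKA); rewrite inE.
by have [/(_ y qy)[]] := tooth_prop Ww.
Qed.

Let inj_code : {in B &, injective code}.
Proof.
have [memp injp _ _] := path_prop.
move=> x y /comb_setP[px|[w Ww qx]] /comb_setP[py|[w' Ww' qy]].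
- by rewrite !code_spine // => -[]; apply: injp.
- by rewrite code_spine // (code_tooth Ww' qy).
- by rewrite [code y]code_spine // (code_tooth Ww qx).
rewrite (code_tooth Ww qx) (code_tooth Ww' qy) => -[/inj_pos ew] ed.
have {}ew := ew Ww Ww'; subst w'; have [memq injq _ _] := tooth_prop Ww.
have [_ lex _] := memq x qx; have [_ ley _] := memq y qy.
by apply: injq => //; lia.
Qed.

Let par_code y : y \in B -> y != r -> exists2 x, x \in B & comb_parent (code x) (code y).
Proof.
have [memp _ parp _] := path_prop.
case/comb_setP=> [py|[w Ww + ]] nyr.
  have [pp _] : par y \in r :: p /\ y != r by apply: parp; move: py; rewrite inE (negbTE nyr).
  exists (par y); first exact: B_spine.
  have [Ay _ _] := memp y py.
  have [_ _ _ dy] := child_prop bfsA (par_child par Ay nyr).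
  by rewrite !code_spine // /comb_parent /= dy !eqxx orbT.
rewrite inE => /predU1P[->|qy].
  have [ltz _] := posW Ww; have [x px dx] := spine_level (ltnW ltz).
  exists x; first exact: B_spine.
  by rewrite code_spine // (code_tooth Ww (mem_head _ _)) /comb_parent /= dx subnn !eqxx.
have [memq _ parq _] := tooth_prop Ww; have [qp _] := parq y qy.
have qy' : y \in w :: hq w by rewrite inE qy orbT.
exists (par y); first exact: B_tooth qp.
have [Ay _ _] := memq y qy'; have [_ lep _] := memq _ qp.
have [_ _ _ dy] := child_prop bfsA (par_child par Ay nyr).
by rewrite (code_tooth Ww qp) (code_tooth Ww qy') /comb_parent /= dy subSn // !eqxx.
Qed.

Let adj_code : {in B &, forall x y, adj x y = comb_adj l (code x) (code y)}.
Proof.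
have spine_tooth x w y : x \in r :: p -> w \in W -> y \in w :: hq w ->
    adj x y = comb_adj l (code x) (code y).
  move=> px Ww qy; rewrite code_spine // (code_tooth Ww qy) adj_sym.
  have Kx : x \in K by rewrite inE.
  move: qy; rewrite inE => /predU1P[->|qy].
    by rewrite attW // subnn; case: (l); clear; comb_lia.
  rewrite (negbTE (tail_nadj Ww qy Kx)); have := tail_level Ww qy.
  by case: (l); clear; comb_lia.
move=> x y /comb_setP[px|[w Ww qx]] /comb_setP[py|[w' Ww' qy]].
- by rewrite (tree_path_adj bfsA Ar path_p) // !code_spine //; case: (l); clear; comb_lia.
- exact: (spine_tooth _ w').
- by rewrite adj_sym comb_adj_sym; apply: (spine_tooth _ w).
have [eww|nww'] := eqVneq w w'; last first.
  have [_ /negbTE->] := apart Ww Ww' nww' qx qy.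
  rewrite (code_tooth Ww qx) (code_tooth Ww' qy).
  have npos : pos w != pos w' by apply: contra nww' => /eqP/inj_pos->.
  by move: npos; case: (l); clear; comb_lia.
subst w'; have [Aw _] := W_sub Ww; have [pq _ _] := hairW Ww.
rewrite (tree_path_adj bfsA Aw pq) // (code_tooth Ww qx) (code_tooth Ww qy).
have [memq _ _ _] := tooth_prop Ww.
have [_ lex _] := memq x qx; have [_ ley _] := memq y qy.
by move: lex ley; case: (l); clear; comb_lia.
Qed.

Let code_r : code r = (0, 0). Proof. by rewrite code_spine ?mem_head // dr. Qed.
Let Br : r \in B. Proof. by rewrite B_spine ?mem_head. Qed.

Let no01 : ~~ l -> forall y, y \in B -> code y != (0, 1).
Proof.
move=> nl y /comb_setP[py|[w Ww qy]]; first by rewrite code_spine // xpair_eqE andbF.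
rewrite (code_tooth Ww qy) xpair_eqE; have [_ gt0] := posW Ww.
by rewrite gtn_eqF ?gt0.
Qed.

Definition comb_ends : {set G} := r |: (z |: [set last w (hq w) | w in W]).

Lemma comb_ends_sub : comb_ends \subset comb_set.
Proof.
apply/subsetP=> y; rewrite 2!in_setU1 => /or3P[/eqP->|/eqP->|/imsetP[w Ww ->]] //.
  by rewrite B_spine ?mem_last.
by apply: B_tooth Ww _; apply: mem_last.
Qed.

Lemma comb_ends_subX : r \in X -> z \in X -> comb_ends \subset X.
Proof.
move=> Xr Xz.
apply/subsetP=> y; rewrite 2!in_setU1 => /or3P[/eqP->|/eqP->|/imsetP[w Ww ->]] //.
by have [] := hairW Ww.
Qed.

(** Distinct hairs are disjoint and avoid the spine, which contributes its two ends; these differ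
    because some tooth is attached before [z]. *)
Lemma card_comb_ends : 0 < #|W| -> #|comb_ends| = #|W|.+2.
Proof.
case/card_gt0P=> w0 /posW[lt0z _].
have nE x : x \in r :: p -> x \notin [set last w (hq w) | w in W].
  move=> px; apply/negP=> /imsetP[w Ww ex].
  by have := hair_notin Ww (mem_last w (hq w)); rewrite in_set -ex px.
rewrite !cardsU1 in_setU1 negb_or !nE ?mem_last ?mem_head // andbT.
have -> : r != z by apply: contraTneq lt0z => <-; rewrite dr.
rewrite card_in_imset // => w w' Ww Ww' e; apply/eqP/negPn/negP=> nww'.
by have [] := apart Ww Ww' nww' (mem_last _ _) (mem_last _ _); rewrite e eqxx.
Qed.

(** By [comb_simplicial], besides the root it remains to find the vertices without a comb child.
    These are [z], as all teeth are attached at lower levels, and the last vertices of the hairs. *)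
Lemma comb_simplicials : [set val x | x in simplicials (induced comb_set)] = comb_ends.
Proof.
have [memp injp parp chip] := path_prop.
apply: simplicials_induced; first exact: comb_ends_sub.
move=> x Bx; split=> [Ex|].
  apply/(comb_simplicial inj_code code_r Br par_code adj_code no01 Bx).
  move: Ex; rewrite 2!in_setU1 => /or3P[/eqP->|/eqP->|/imsetP[w Ww ->]]; first by left.
    right=> y /comb_setP[py|[w Ww qy]].
      rewrite !code_spine ?mem_last //; have [_ _ ley] := memp y py.
      by move: ley; clear; comb_lia.
    rewrite code_spine ?mem_last // (code_tooth Ww qy).
    by have [ltz _] := posW Ww; move: ltz; clear; comb_lia.
  have ql := mem_last w (hq w); have [memq _ _ _] := tooth_prop Ww.
  right=> y /comb_setP[py|[w' Ww' qy]].
    by rewrite [code y]code_spine // (code_tooth Ww ql); clear; comb_lia.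
  rewrite (code_tooth Ww ql) (code_tooth Ww' qy).
  have [eww|nww'] := eqVneq w w'; last first.
    have npos : pos w != pos w' by apply: contra nww' => /eqP/inj_pos->.
    by move: npos; clear; comb_lia.
  by subst w'; have [_ _ ley] := memq y qy; have [_ lel _] := memq _ ql;
    move: ley lel; clear; comb_lia.
move/(comb_simplicial inj_code code_r Br par_code adj_code no01 Bx).
case=> [->|leafx]; first by rewrite in_setU1 eqxx.
rewrite 2!in_setU1; case/comb_setP: Bx => [px|[w Ww qx]].
  have [|nxz] := eqVneq x z; first by rewrite orbT.
  have [y py xy] := chip x px nxz; have py' : y \in r :: p by rewrite inE py orbT.
  have := leafx y (B_spine py'); rewrite !code_spine //.
  by have [_ _ _ ->] := child_prop bfsA xy; rewrite /comb_parent /= !eqxx orbT.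
have [->|nxl] := eqVneq x (last w (hq w)); first by rewrite imset_f ?orbT.
have [memq _ _ chiq] := tooth_prop Ww; have [y qy xy] := chiq x qx nxl.
have qy' : y \in w :: hq w by rewrite inE qy orbT.
have := leafx y (B_tooth Ww qy'); rewrite (code_tooth Ww qx) (code_tooth Ww qy').
have [_ lex _] := memq x qx; have [_ _ _ ->] := child_prop bfsA xy.
by rewrite subSn // /comb_parent /= !eqxx.
Qed.

(** One tooth suffices. With [l], the tooth root and the next spine vertex are the siblings needed
    for the line graph. Without [l], the spine vertex at level [pos w] is a branch vertex, as
    [0 < pos w] provides a previous one. *)
Lemma comb_set_shape : 0 < #|W| ->
  is_caterpillar (induced comb_set) \/ is_line_graph_of_caterpillar (induced comb_set).
Proof.
case/card_gt0P=> w Ww; have [ltz gt0] := posW Ww.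
pose c (x : induced comb_set) := code (val x).
have injc : injective c.
  by move=> x y /inj_code exy; apply/val_inj/exy; [apply: (valP x)|apply: (valP y)].
pose r' : induced comb_set := exist _ r Br.
have parc (y : induced comb_set) : y != r' -> exists x, comb_parent (c x) (c y).
  rewrite -val_eqE /= => nyr; have [x Bx xy] := par_code (valP y) nyr.
  by exists (exist _ x Bx).
have adjc (x y : induced comb_set) : adj x y = comb_adj l (c x) (c y).
  by rewrite /= /induced_adj adj_code //; [apply: (valP x)|apply: (valP y)].
pose w' : induced comb_set := exist _ w (B_tooth Ww (mem_head _ _)).
have cw : c w' = (pos w, 1) by rewrite /c /= (code_tooth Ww (mem_head _ _)) subnn.
have [x2 px2 dx2] := spine_level ltz.
pose x2' : induced comb_set := exist _ x2 (B_spine px2).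
have cx2 : c x2' = ((pos w).+1, 0) by rewrite /c /= code_spine // dx2.
case: (l) adjc gt0 => adjc gt0.
  by right; apply: (comb_line_graph injc (r := r') code_r parc adjc cx2 cw).
left; have [x0 px0 dx0] : exists2 x, x \in r :: p & d x = (pos w).-1.
  by apply: spine_level; lia.
pose x0' : induced comb_set := exist _ x0 (B_spine px0).
have cx0 : c x0' = ((pos w).-1, 0) by rewrite /c /= code_spine // dx0.
have pw := prednK (gt0 isT).
by apply: (comb_caterpillar injc (r := r') code_r parc adjc cx0 (x1 := w') (x2 := x2'));
  rewrite pw.
Qed.

End Comb.

(** * Subdivided stars formed by hairs around the root *)

Section SpiderSet.

Variables (G : sgraph) (A X : {set G}) (v : G) (d : G -> nat) (par : G -> G).
Hypothesis bfsA : bfs_tree A v d par.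
Notation child := (child A v par).

Variables (W : {set G}) (hq : G -> seq G).
Hypothesis W_sub : {in W, forall w, w \in A /\ adj v w}.
Hypothesis stableW : stable W.
Hypothesis hairW : {in W, forall w, hair A v par X w (hq w)}.
Hypothesis cardW : 3 <= #|W|.

Let Av : v \in A. Proof. by have [] := bfsA. Qed.
Let dv : d v = 0. Proof. by have [] := bfsA. Qed.

Let subKA : [set v] \subset A. Proof. by rewrite sub1set. Qed.

Let conK : {in W & [set v], forall w x, connect (adj_in (A :\ w)) x v}.
Proof. by move=> w x _ /set1P->. Qed.

Let W_att : {in W, forall w,
  [/\ w \in A, w \notin [set v] & exists2 x, x \in [set v] & adj w x]}.
Proof.
move=> w /W_sub[Aw vw]; split=> //; last by exists v; rewrite ?set11 // adj_sym.
by rewrite inE; apply: contraTneq vw => ->; rewrite adj_irr.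
Qed.

Let apart := hairs_apart bfsA subKA conK W_att stableW hairW.
Let tail_nadj := hair_tail_nadj_K subKA conK W_att hairW.
Let hair_notin := hair_notin_K conK W_att hairW.

Definition spider_set : {set G} :=
  [set y | (y == v) || [exists w in W, y \in w :: hq w]].

Definition spider_ends : {set G} := [set last w (hq w) | w in W].

Let leg (y : G) : G := odflt v [pick w in W | y \in w :: hq w].
Let B := spider_set.

Lemma spider_setP y : y \in spider_set -> y = v \/ exists2 w, w \in W & y \in w :: hq w.
Proof. by rewrite in_set => /orP[/eqP|/exists_inP[w]]; [left|right; exists w]. Qed.

Let B_leg w y : w \in W -> y \in w :: hq w -> y \in B.
Proof. by move=> Ww qy; rewrite in_set; apply/orP; right; apply/exists_inP; exists w. Qed.

Let Bv : v \in B. Proof. by rewrite in_set eqxx. Qed.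

Let legE w y : w \in W -> y \in w :: hq w -> leg y = w.
Proof.
move=> Ww qy; rewrite /leg.
case: pickP => [w' /andP[Ww' qy'] /=|/(_ w)]; last by rewrite Ww qy.
have [//|nww'] := eqVneq w' w.
by have [] := apart Ww' Ww nww' qy' qy; rewrite eqxx.
Qed.

Let dW w : w \in W -> d w = 1.
Proof.
move=> Ww; have [Aw vw] := W_sub Ww; have [_ nvw _] := W_att Ww.
have [_] := bfs_adj bfsA Av Aw vw; rewrite dv.
have nwv : w != v by rewrite inE in nvw.
by have [_ _ _ ->] := child_prop bfsA (par_child par Aw nwv); case: (d _).
Qed.

Let leg_prop w : w \in W ->
  [/\ {in w :: hq w, forall y, [/\ y \in A, d w <= d y & d y <= d (last w (hq w))]},
      {in w :: hq w &, injective d},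
      {in hq w, forall y, par y \in w :: hq w /\ y != v} &
      {in w :: hq w, forall y, y != last w (hq w) -> exists2 c, c \in hq w & child y c}].
Proof.
move=> Ww; have [Aw _] := W_sub Ww; have [pq _ _] := hairW Ww.
exact: tree_path_prop.
Qed.

Let leg_gt0 w y : w \in W -> y \in w :: hq w -> 0 < d y.
Proof. by move=> Ww qy; have [/(_ y qy)[_ + _] _ _ _] := leg_prop Ww; rewrite dW. Qed.

Let tail_par w y : w \in W -> y \in hq w ->
  par y \in w :: hq w /\ d y = (d (par y)).+1.
Proof.
move=> Ww qy; have [memq _ parq _] := leg_prop Ww.
have [qp nyv] := parq y qy; have [|Ay _ _] := memq y; first by rewrite inE qy orbT.
by have [_ _ _ ->] := child_prop bfsA (par_child par Ay nyv).
Qed.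

Lemma spider_set_sub : spider_set \subset A.
Proof.
apply/subsetP=> y /spider_setP[->//|[w Ww qy]].
by have [/(_ y qy)[]] := leg_prop Ww.
Qed.

(** The legs are hairs at the neighbors [W] of the tree root [v], so [hairs_apart] with [K =
    [set v]] keeps different legs anticomplete, and each leg is a geodesic. *)
Lemma spider_set_spider : spider d leg v spider_set.
Proof.
split=> //.
- move=> x y /spider_setP[->|[w Ww qx]] /spider_setP[->|[w' Ww' qy]] //.
  + by have := leg_gt0 Ww' qy; rewrite dv => + e; rewrite -e.
  + by have := leg_gt0 Ww qx; rewrite dv => + e; rewrite e.
  move=> exy; rewrite (gtn_eqF (leg_gt0 Ww qx)) /=.
  rewrite (legE Ww qx) (legE Ww' qy) => /eqP eww; subst w'.
  by have [_ injq _ _] := leg_prop Ww; apply: injq.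
- move=> y /spider_setP[->|[w Ww]]; first by rewrite dv.
  rewrite inE => /predU1P[-> _|qy _].
    by exists v; rewrite // /spider_parent dv dW.
  have [qp dy] := tail_par Ww qy; exists (par y); first exact: B_leg qp.
  have qy' : y \in w :: hq w by rewrite inE qy orbT.
  by rewrite /spider_parent dy eqxx (legE Ww qp) (legE Ww qy') eqxx orbT.
have center_leg w y : w \in W -> y \in w :: hq w ->
    adj v y = spider_parent d leg v y || spider_parent d leg y v.
  move=> Ww; rewrite /spider_parent dv orbF andbT inE => /predU1P[->|qy].
    by have [_ ->] := W_sub Ww; rewrite dW.
  have [qp ->] := tail_par Ww qy; rewrite adj_sym eqSS gtn_eqF ?(leg_gt0 Ww qp) //.
  by apply/negbTE/(tail_nadj Ww qy); rewrite inE.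
move=> x y /spider_setP[->|[w Ww qx]] /spider_setP[->|[w' Ww' qy]].
- by rewrite adj_irr /spider_parent dv.
- exact: center_leg qy.
- by rewrite adj_sym orbC; apply: center_leg qx.
rewrite /spider_parent (gtn_eqF (leg_gt0 Ww qx)) (gtn_eqF (leg_gt0 Ww' qy)) /=.
rewrite (legE Ww qx) (legE Ww' qy) [w' == w]eq_sym -andb_orl.
have [eww|nww'] := eqVneq w w'; last first.
  by have [_ /negbTE->] := apart Ww Ww' nww' qx qy; rewrite andbF.
subst w'; have [Aw _] := W_sub Ww; have [pq _ _] := hairW Ww.
by rewrite (tree_path_adj bfsA Aw pq) // andbT ![_ == _.+1]eq_sym.
Qed.

Lemma spider_set_shape : is_subdivided_star (induced spider_set).
Proof.
exists #|W|; split=> //.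
suff -> : W = [set x in spider_set | d x == 1].
  exact: spider_subdivision spider_set_spider.
apply/setP=> x; rewrite inE; apply/idP/andP=> [Wx|[/spider_setP[->|[w Ww]]]].
- by rewrite (B_leg Wx (mem_head _ _)) dW.
- by rewrite dv.
rewrite inE => /predU1P[->//|qx]; have [qp ->] := tail_par Ww qx.
by rewrite eqSS gtn_eqF ?(leg_gt0 Ww qp).
Qed.

Lemma spider_ends_sub : spider_ends \subset spider_set.
Proof. by apply/subsetP=> _ /imsetP[w Ww ->]; apply: B_leg Ww _; apply: mem_last. Qed.

Lemma spider_ends_subX : spider_ends \subset X.
Proof. by apply/subsetP=> _ /imsetP[w Ww ->]; have [] := hairW Ww. Qed.

Lemma card_spider_ends : #|spider_ends| = #|W|.
Proof.
rewrite card_in_imset // => w w' Ww Ww' e; apply/eqP/negPn/negP=> nww'.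
by have [] := apart Ww Ww' nww' (mem_last _ _) (mem_last _ _); rewrite e eqxx.
Qed.

(** The end of a leg has only its parent as neighbor. The center sees two non-adjacent vertices of
    [W], and an inner leg vertex sees a parent and a child two levels apart. *)
Lemma spider_simplicials :
  [set val x | x in simplicials (induced spider_set)] = spider_ends.
Proof.
have [_ _ injd pard adjd] := spider_set_spider.
apply: simplicials_induced; first exact: spider_ends_sub.
move=> x Bx; split=> [/imsetP[w Ww ex]|simx].
  have ql := mem_last w (hq w); rewrite -ex in ql.
  have nbr y : y \in B -> adj x y -> spider_parent d leg y x.
    move=> By; rewrite adjd // => /orP[|//]; rewrite /spider_parent.
    rewrite (gtn_eqF (leg_gt0 Ww ql)) /= (legE Ww ql).
    case/spider_setP: By => [->|[w' Ww' qy]]; first by rewrite dv.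
    rewrite (legE Ww' qy) => /andP[/eqP dy /eqP eww]; subst w'.
    by have [/(_ y qy)[_ _ +] _ _ _] := leg_prop Ww; rewrite -ex dy ltnn.
  move=> y z By Bz /(nbr y By)/andP[/eqP dy ly] /(nbr z Bz)/andP[/eqP dz lz] /eqP[].
  have ed : d y = d z by apply: succn_inj; rewrite -dy.
  apply: injd => //; case: eqP ly lz => //= nz /eqP->; rewrite -ed.
  by case: eqP => //= _; rewrite eq_sym.
case/spider_setP: (Bx) => [xv|[w Ww qx]].
  have /card_gt1P[w [w' [Ww Ww' nww']]] : 1 < #|W| by apply: ltnW.
  have [[Aw vw] [Aw' vw']] := (W_sub Ww, W_sub Ww').
  have := simx w w' (B_leg Ww (mem_head _ _)) (B_leg Ww' (mem_head _ _)).
  rewrite xv => /(_ vw vw' nww').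
  by rewrite (negbTE (stableW Ww Ww')).
have [->|nxl] := eqVneq x (last w (hq w)); first exact: imset_f.
have [memq _ _ chiq] := leg_prop Ww; have [y qy xy] := chiq x qx nxl.
have By : y \in B by apply: (B_leg Ww); rewrite inE qy orbT.
have [_ _ axy dy] := child_prop bfsA xy.
have [z Bz zx] := pard x Bx (leg_gt0 Ww qx); have /andP[/eqP dx _] := zx.
have axz : adj x z by rewrite adjd // zx orbT.
have nyz : y != z.
  by apply/eqP=> e; move: dy; rewrite e dx; elim: (d z) => // n IHn [/IHn].
have := simx y z By Bz axy axz nyz; rewrite adjd // /spider_parent dy dx.
have -> : d z == (d z).+3 = false by elim: (d z).
by have -> : (d z).+2 == (d z).+1 = false by elim: (d z).
Qed.

End SpiderSet.

(** * Terminals and heavy paths *)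

Lemma leq_card_bigcup (I T : finType) (P : pred I) (F : I -> {set T}) n :
  (forall i, P i -> #|F i| <= n) -> #|\bigcup_(i | P i) F i| <= #|[set i | P i]| * n.
Proof.
move=> leF; apply: (@leq_trans (\sum_(i | P i) #|F i|)).
  elim/big_rec2: _ => [|i k B _ leB]; first by rewrite cards0.
  by apply: leq_trans (leq_card_setU _ _) _; rewrite leq_add2l.
rewrite -sum_nat_const; under [leqRHS]eq_bigl do rewrite inE.
exact: leq_sum.
Qed.

Section HeavyPath.

Variables (G : sgraph) (A : {set G}) (r : G) (d : G -> nat) (par : G -> G).
Hypothesis bfsA : bfs_tree A r d par.
Notation child := (child A r par).

Variables (S : {set G}) (v : G -> G) (m D : nat).
Hypothesis v_few : {in A, forall a, #|[set s in S | v s == a]| <= m}.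
Hypothesis child_few : {in A, forall a, #|[set c | child a c]| <= D}.

(** A descent can lose terminals only here: some are attached at [a], or they are spread over
    several children. *)
Definition event (a : G) : bool :=
  [exists s in S, v s == a] || (1 < #|[set c | child a c]|).

(** Enough terminals to force [k] events: at an event at most [m] of them stop, and one of at most
    [D] children keeps [heavy_bound k']. The successor rules out a childless vertex when [k] is
    positive. *)
Fixpoint heavy_bound k := if k is k'.+1 then (m + D * heavy_bound k').+1 else 0.

Lemma heavy_bound_gt0 k : 0 < k -> 0 < heavy_bound k.
Proof. by case: k. Qed.

Definition below (a : G) : {set G} := [set s in S | connect child a (v s)].

Lemma below_sub a : below a \subset
  [set s in S | v s == a] :|: \bigcup_(c | child a c) below c.
Proof.
apply/subsetP=> s; rewrite in_setU !inE => /andP[Ss /connectP[[|c q] /= pq vs]].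
  by rewrite Ss vs eqxx.
case/andP: pq => ac pq; apply/orP; right; apply/bigcupP; exists c => //.
by rewrite inE Ss; apply/connectP; exists q.
Qed.

(* Descending to a child that carries the most terminals loses terminals only
   at events. *)
Lemma heavy_path a k : a \in A -> heavy_bound k <= #|below a| ->
  exists p, [/\ path child a p, childless A r par (last a p) &
                k <= count event (a :: p)].
Proof.
move: {2}(\max_y d y - d a) (leqnn (\max_y d y - d a)) => n.
elim: n a k => [|n IHn] a k len Aa lek.
all: have [la|] := boolP (childless A r par a).
(* At most [m] terminals lie below a childless vertex, which forces [k = 0]. *)
1,3: exists [::]; split=> //; case: k lek => //= k lek.
1,2: suff: #|below a| <= m by move: lek; lia.
1,2: apply: leq_trans (v_few Aa); apply/subset_leq_card/(subset_trans (below_sub a)).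
1,2: rewrite big1 ?setU0 // => c ac; by move/forallP/(_ c): la; rewrite ac.
all: rewrite negb_forall => /existsP[c0]; rewrite negbK => ac0.
all: have next c : child a c -> \max_y d y - d c < \max_y d y - d a by
  move=> ac; have [_ _ _ dc] := child_prop bfsA ac;
  have := leq_bigmax (F := d) c; rewrite dc; clear; lia.
  by have := next c0 ac0; move: len; clear; lia.
have step c k' : child a c -> heavy_bound k' <= #|below c| -> exists p,
    [/\ path child a p, childless A r par (last a p) & event a + k' <= count event (a :: p)].
  move=> ac lek'; have [_ Ac _ _] := child_prop bfsA ac.
  have len' : \max_y d y - d c <= n by have := next c ac; move: len; clear; lia.
  have [p [pp lp kp]] := IHn c k' len' Ac lek'.
  by exists (c :: p); split; rewrite //= ?ac // leq_add2l.
have [ea|nea] := boolP (event a).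
  case: k lek => [|k] lek; first by have [p [? ? ?]] := step c0 0 ac0 isT; exists p.
  suff [c ac lekc] : exists2 c, child a c & heavy_bound k <= #|below c|.
    by have := step c k ac lekc; rewrite ea.
  apply/exists_inP; apply: contraLR lek; rewrite negb_exists_in => /forall_inP small.
  rewrite -ltnNge /= ltnS; apply: leq_trans (subset_leq_card (below_sub a)) _.
  apply: leq_trans (leq_card_setU _ _) _; apply: leq_add; first exact: v_few.
  apply: leq_trans (leq_card_bigcup (n := heavy_bound k) _) _.
    by move=> c ac; have := small c ac; rewrite -ltnNge; apply: ltnW.
  by rewrite leq_mul2r child_few ?orbT.
(* Without an event there is a single child, and it inherits all terminals. *)
have := step c0 k ac0; rewrite (negbTE nea) add0n; apply.
apply: leq_trans lek _; apply/subset_leq_card/(subset_trans (below_sub a)).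
move: nea; rewrite negb_or -leqNgt negb_exists_in => /andP[/forall_inP no_s le1].
apply/subsetP=> s /setUP[|/bigcupP[c ac]].
  by rewrite inE => /andP[/no_s/negbTE->].
suff -> : c = c0 by [].
move/card_le1_eqP: le1; apply; by rewrite inE.
Qed.

End HeavyPath.

(** * The outcomes of the theorem *)

Definition unavoidable (h : nat) (G : sgraph) (S : {set G}) : Prop :=
  exists St : {set G}, exists A : {set G},
    [/\ St \subset S, #|St| = h, A \subset ~: S &
      (is_path (induced A) /\
       forall s : G, s \in St -> exists2 y : G, y \in A & adj s y)
      \/
      [/\ is_caterpillar (induced A) \/
          is_line_graph_of_caterpillar (induced A) \/
          is_subdivided_star (induced A),
          forall s : G, s \in St -> exists! y : G, y \in A /\ adj s y &
          A :&: set_nbhd St = [set val x | x in simplicials (induced A)]]].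

Lemma unavoidable_path h (G : sgraph) (S P : {set G}) :
    P \subset ~: S -> is_path (induced P) ->
    h <= #|[set s in S | [exists y in P, adj s y]]| ->
  unavoidable h S.
Proof.
move=> sP pathP /exists_subset_card[St sSt cardSt]; exists St, P; split=> //.
  by apply: subset_trans sSt _; apply/subsetP=> s; rewrite inE => /andP[].
left; split=> // s /(subsetP sSt); rewrite inE => /andP[_ /exists_inP[y Py sy]].
by exists y.
Qed.

Definition private (G : sgraph) (S A : {set G}) : {set G} :=
  [set x in A | [exists s in S, [forall y in A, adj s y == (y == x)]]].

Lemma privateP (G : sgraph) (S A : {set G}) : exists f : G -> G,
  {in private S A, forall x, f x \in S /\ {in A, forall y, adj (f x) y = (y == x)}}.
Proof.
have ex x : exists s, x \in private S A ->
    s \in S /\ {in A, forall y, adj s y = (y == x)}.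
  have [|_] := boolP (x \in private S A); last by exists x.
  rewrite inE => /andP[_ /exists_inP[s Ss /forall_inP sP]].
  by exists s => _; split=> // y /sP/eqP.
by have [f fP] := fin_all_exists ex; exists f.
Qed.

(** Each end [x] in [Z] has a terminal [f x] whose only neighbor in [A], hence in [H], is [x]. So
    [f] is injective on [Z], and the chosen terminals see exactly [Z] in [H]. *)
Lemma unavoidable_ends (G : sgraph) (S A H Z : {set G}) :
    A \subset ~: S -> H \subset A -> Z \subset H -> Z \subset private S A ->
    is_caterpillar (induced H) \/ is_line_graph_of_caterpillar (induced H) \/
      is_subdivided_star (induced H) ->
    [set val x | x in simplicials (induced H)] = Z ->
  unavoidable #|Z| S.
Proof.
move=> sAS sHA sZH sZX shapeH simpH; have [f fP] := privateP S A.
have {}fP x : x \in Z -> f x \in S /\ {in H, forall y, adj (f x) y = (y == x)}.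
  move=> /(subsetP sZX)/fP[Sf adjf]; split=> // y /(subsetP sHA); exact: adjf.
have injf : {in Z &, injective f}.
  move=> x y Zx Zy exy; have [_ adjx] := fP x Zx; have [_ adjy] := fP y Zy.
  have Hx := subsetP sZH x Zx.
  by apply/eqP; rewrite -adjy // -exy adjx.
exists (f @: Z), H; split.
- by apply/subsetP=> _ /imsetP[x /fP[Sf _] ->].
- exact: card_in_imset.
- exact: subset_trans sHA sAS.
right; split=> //.
  move=> _ /imsetP[x Zx ->]; have [_ adjx] := fP x Zx.
  have Hx := subsetP sZH x Zx; exists x; split=> [|y [Hy]].
    by split; rewrite // adjx.
  by rewrite adjx // => /eqP.
rewrite simpH; apply/setP=> y; rewrite !inE; apply/idP/idP.
  case/and3P=> Hy _ /exists_inP[_ /imsetP[x Zx ->]].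
  by have [_ ->] := fP x Zx => // /eqP->.
move=> Zy; have Hy := subsetP sZH y Zy; rewrite Hy /=; apply/andP; split.
  apply/imsetP=> -[x /fP[Sf _] ey].
  by have := subsetP sAS _ (subsetP sHA _ Hy); rewrite inE ey Sf.
by apply/exists_inP; exists (f y); [apply: imset_f|have [_ ->] := fP y Zy].
Qed.

Lemma tree_path_is_path (G : sgraph) (A : {set G}) r d par x q :
    bfs_tree A r d par -> x \in A -> path (child A r par) x q -> d x = 0 ->
  is_path (induced [set y in x :: q]).
Proof.
move=> bfsA Ax pq dx; have [memq injq parq _] := tree_path_prop bfsA Ax pq.
apply: (path_of_code (c := d)).
- by apply/card_gt0P; exists x; rewrite in_set mem_head.
- by move=> y z; rewrite !in_set; apply: injq.
- move=> y i; rewrite in_set => qy dy; exists (par y); last first.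
    apply: succn_inj; rewrite -dy; have [Ay _ _] := memq y qy.
    have [|nyr] := eqVneq y r; first by have [_ dr _ _] := bfsA => ey; rewrite ey dr in dy.
    by have [_ _ _ ->] := child_prop bfsA (par_child par Ay nyr).
  rewrite in_set; move: qy; rewrite in_cons => /predU1P[ey|/parq[]//].
  by rewrite ey dx in dy.
- by move=> y z; rewrite !in_set => qy qz; rewrite (tree_path_adj bfsA Ax pq).
Qed.

(** * Teeth along a tree path *)

Section Teeth.

Variables (h : nat) (G : sgraph) (S A : {set G}) (r : G) (d : G -> nat) (par : G -> G).
Hypothesis h_ge3 : 3 <= h.
Hypothesis no_clique : forall K : {set G}, clique K -> #|K| <> h.
Hypothesis sAS : A \subset ~: S.
Hypothesis bfsA : bfs_tree A r d par.
Notation child := (child A r par).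
Notation X := (private S A).
Hypothesis noncutX : {in A, forall x, connected_in (A :\ x) -> x \in X}.

Let Ar : r \in A. Proof. by have [] := bfsA. Qed.
Let dr : d r = 0. Proof. by have [] := bfsA. Qed.

Lemma stable_subset (W : {set G}) : 2 ^ (h + h) <= #|W| ->
  exists I : {set G}, [/\ I \subset W, stable I & #|I| = h].
Proof. by case/ramsey=> [[K [_ cK /(no_clique cK)]]|]. Qed.

Lemma hair_choice (W : {set G}) : {in W, forall w, w \in A /\ w != r} ->
  exists hq, {in W, forall w, hair A r par X w (hq w)}.
Proof.
move=> W_sub; have ex w : exists q, w \in W -> hair A r par X w q.
  have [Ww|_] := boolP (w \in W); last by exists [::].
  by have [Aw nwr] := W_sub w Ww; have [q] := hair_exists bfsA noncutX Aw nwr; exists q.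
by have [hq hqP] := fin_all_exists ex; exists hq.
Qed.

(** The tree is rooted at the vertex of large degree, which becomes the center of the star. *)
Lemma unavoidable_high_degree :
  2 ^ (h + h) <= #|[set w in A | adj r w]| -> unavoidable h S.
Proof.
case/stable_subset=> W [sW stW cardW].
have W_sub : {in W, forall w, w \in A /\ adj r w}.
  by move=> w /(subsetP sW); rewrite inE => /andP.
have [|hq hairW] := hair_choice (W := W).
  move=> w /W_sub[Aw rw]; split=> //.
  by apply: contraTneq rw => ->; rewrite adj_irr.
have cardW3 : 3 <= #|W| by rewrite cardW.
rewrite -cardW -(card_spider_ends bfsA W_sub stW hairW).
apply: (unavoidable_ends sAS (spider_set_sub bfsA W_sub hairW)).
- exact: spider_ends_sub.
- exact: spider_ends_subX hairW.
- by right; right; apply: (spider_set_shape bfsA W_sub stW hairW).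
- exact: (spider_simplicials bfsA W_sub stW hairW).
Qed.

Variable p : seq G.
Local Notation z := (last r p).
Hypothesis path_p : path child r p.
Hypothesis leaf_z : childless A r par z.
Hypothesis rX : r \in X.

Let path_prop := tree_path_prop bfsA Ar path_p.

Definition tooth (l : bool) (x w : G) : bool :=
  [&& w \in A, w \notin r :: p &
      [forall y in r :: p, adj w y == (d y == d x) || l && (d y == (d x).+1)]].

(** The last spine vertex [z] is excluded so that it remains an end. Without [l] the root is
    excluded too, since a hair attached to it alone would give it two non-adjacent neighbors. *)
Definition teeth (l : bool) : {set G} :=
  [set x | [&& x \in r :: p, l || (x != r), x != z & [exists w, tooth l x w]]].

Lemma spine_end_private : z \in X.
Proof.
have [/(_ z (mem_last _ _))[Az _ _] _ _ _] := path_prop.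
by apply: noncutX => //; apply: (childless_noncut bfsA leaf_z).
Qed.

(** Choosing one tooth root per position and passing to a stable subset by Ramsey's theorem makes
    the hairs anticomplete; together with the path they form a comb whose ends are all private. *)
Lemma unavoidable_teeth l : 2 ^ (h + h) <= #|teeth l| -> unavoidable h S.
Proof.
move=> many; have [memp injp _ _] := path_prop.
pose w_of x := odflt r [pick w | tooth l x w].
have w_ofP x : x \in teeth l -> [/\ w_of x \in A, w_of x \notin r :: p &
    {in r :: p, forall y, adj (w_of x) y = (d y == d x) || l && (d y == (d x).+1)}].
  rewrite inE => /and4P[_ _ _ /existsP[w0 w0P]]; rewrite /w_of.
  case: pickP => [w /and3P[Aw npw /forall_inP wP] /=|/(_ w0)]; last by rewrite w0P.
  by split=> // y /wP/eqP.
have teethp x : x \in teeth l -> x \in r :: p by rewrite in_set => /and4P[].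
(* If two positions share a tooth root, each level is at least the other, so they coincide. *)
have injw : {in teeth l &, injective w_of}.
  move=> x y Tx Ty exy; have [_ _ adjx] := w_ofP x Tx; have [_ _ adjy] := w_ofP y Ty.
  have := adjx y (teethp _ Ty); rewrite exy adjy ?teethp // eqxx /= => /esym lexy.
  have := adjy x (teethp _ Tx); rewrite -exy adjx ?teethp // eqxx /= => /esym leyx.
  by apply: injp; rewrite ?teethp //; move: lexy leyx; clear; lia.
have [|I [sI stI cardI]] := stable_subset (W := w_of @: teeth l).
  by rewrite card_in_imset.
(* Only [h.-2] teeth are kept: [r] and [z] supply the other two ends. *)
have [|W sWI cardW] := exists_subset_card (B := I) (k := h.-2).
  by rewrite cardI -subn2 leq_subr.
pose pos w := d (odflt r [pick x in teeth l | w_of x == w]).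
have posP w : w \in W -> exists2 x, x \in teeth l & w = w_of x /\ pos w = d x.
  move=> /(subsetP sWI)/(subsetP sI)/imsetP[x Tx ->]; exists x => //; split=> //.
  rewrite /pos; case: pickP => [x' /andP[Tx' /eqP/injw->]|/(_ x)] //.
  by rewrite Tx eqxx.
have W_sub : {in W, forall w, w \in A /\ w \notin r :: p}.
  by move=> w /posP[x /w_ofP[Aw npw _] [-> _]].
have stW : stable W by move=> x y /(subsetP sWI) Ix /(subsetP sWI); apply: stI.
have [|hq hairW] := hair_choice (W := W).
  move=> w /W_sub[Aw npw]; split=> //; apply: contraNneq npw => ->; exact: mem_head.
have attW : {in W, forall w, {in r :: p, forall x,
    adj w x = (d x == pos w) || l && (d x == (pos w).+1)}}.
  by move=> w /posP[x /w_ofP[_ _ wP] [ew ->]] y py; rewrite ew wP.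
have posW : {in W, forall w, pos w < d z /\ (~~ l -> 0 < pos w)}.
  move=> w /posP[x Tx [_ ->]]; have px := teethp x Tx.
  move: Tx; rewrite in_set => /and4P[_ nxr nxz _]; have [_ _ lex] := memp x px.
  split; first by rewrite ltn_neqAle lex andbT;
    apply: contra nxz => /eqP/injp->; rewrite ?mem_last.
  move=> nl; rewrite (negbTE nl) /= in nxr; rewrite lt0n -dr.
  by apply: contra nxr => /eqP/injp->; rewrite ?mem_head.
have inj_pos : {in W &, injective pos}.
  move=> w w' /posP[x Tx [-> ->]] /posP[x' Tx' [-> ->]] exx'.
  by rewrite (injp x x') ?teethp.
have W_gt0 : 0 < #|W| by rewrite cardW; move: h_ge3; clear; lia.
have cardZ := card_comb_ends bfsA path_p W_sub stW hairW attW posW W_gt0.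
have -> : h = #|comb_ends r p W hq|.
  by rewrite cardZ cardW; move: h_ge3; clear; lia.
apply: (unavoidable_ends sAS (comb_set_sub bfsA path_p W_sub hairW)).
- exact: comb_ends_sub.
- exact: comb_ends_subX hairW rX spine_end_private.
- have [] := comb_set_shape bfsA path_p W_sub stW hairW attW posW inj_pos W_gt0; tauto.
- exact: (comb_simplicials bfsA path_p W_sub stW hairW attW posW inj_pos).
Qed.

(** By levels, a child [c] of [x] off the path sees on it at most [x], its successor [x1] and the
    next vertex [x2]. If [c] misses [x2], it is a tooth at [x], the root being listed apart.
    Otherwise [c] bypasses [x1]: either [x1] is private, or a child cut off by [x1] is a tooth
    attached to [x1] alone. In both cases [x] is recovered as the parent of [x1]. *)
Lemma branching_spine x : x \in r :: p -> 1 < #|[set c | child x c]| ->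
  x \in r |: teeth false :|: teeth true
    :|: par @: (X :&: [set y in r :: p]) :|: par @: teeth false.
Proof.
move=> px /card_gt1P[c1 [c2 [xc1 xc2 nc12]]]; rewrite !in_set in xc1 xc2.
have [memp injp parp chip] := path_prop.
have nxz : x != z by apply: contraTneq xc1 => ->; move/forallP: leaf_z.
have [x1 px1 xx1] := chip x px nxz.
have px1' : x1 \in r :: p by rewrite inE px1 orbT.
have [Ax Ax1 axx1 dx1] := child_prop bfsA xx1.
have [nx1r /eqP parx1] : x1 != r /\ par x1 == x by case/and3P: xx1.
(* Both children have the same level, so at most one of them is on the path. *)
have [c xc npc] : exists2 c, child x c & c \notin r :: p.
  have [pc1|] := boolP (c1 \in r :: p); last by exists c1.
  have [pc2|] := boolP (c2 \in r :: p); last by exists c2.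
  case/eqP: nc12; apply: injp => //.
  by have [_ _ _ ->] := child_prop bfsA xc1; have [_ _ _ ->] := child_prop bfsA xc2.
have [_ Ac axc dc] := child_prop bfsA xc.
have [->|nxr] := eqVneq x r; first by rewrite !in_setU set11.
have neqc y : y \in r :: p -> y != c by move=> py; apply: contraNneq npc => <-.
have [/exists_inP[x2 px2 /andP[/eqP dx2 acx2]]|no_x2] :=
  boolP [exists y in r :: p, (d y == (d x).+2) && adj c y]; last first.
  suff [l Tx] : exists l, x \in teeth l.
    by rewrite !in_setU; case: l Tx => ->; rewrite ?orbT.
  (* The kind of tooth depends on whether [c] sees [x1]. *)
  exists (adj c x1); rewrite in_set px nxr nxz orbT /=; apply/existsP; exists c.
  rewrite /tooth Ac npc /=; apply/forall_inP=> y py; apply/eqP.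
  have [Ay _ _] := memp y py.
  have [->|nyx] := eqVneq y x; first by rewrite adj_sym axc eqxx.
  have -> : d y == d x = false by apply: contraNF nyx => /eqP/injp->.
  have [->|nyx1] := eqVneq y x1; first by rewrite dx1 eqxx andbT.
  have -> : d y == (d x).+1 = false by apply: contraNF nyx1; rewrite -dx1 => /eqP/injp->.
  rewrite andbF; apply/negP=> acy; case/exists_inP: no_x2; exists y => //.
  rewrite acy andbT; have [] := bfs_adj bfsA Ac Ay acy; rewrite dc.
  have: d y != d x by apply: contra nyx => /eqP/injp->.
  have: d y != d x1 by apply: contra nyx1 => /eqP/injp->.
  by rewrite dx1; clear; lia.
suff: x1 \in X \/ x1 \in teeth false.
  rewrite !in_setU; case=> [Xx1|Tx1].
    suff -> : x \in par @: (X :&: [set y in r :: p]) by rewrite !orbT.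
    by apply/imsetP; exists x1 => //; rewrite in_setI Xx1 in_set px1'.
  suff -> : x \in par @: teeth false by rewrite !orbT.
  by apply/imsetP; exists x1.
have [|nXx1] := boolP (x1 \in X); [by left|right].
have [|c' x1c' Dc'] := cut_off_child bfsA Ax1 nx1r.
  by move=> /(noncutX Ax1); apply/negP.
have [_ Ac' ax1c' dc'] := child_prop bfsA x1c'.
have nxx1 : x != x1 by apply/eqP=> e; move: dx1; rewrite -e; clear; lia.
(* [x2] stays connected to the root through [c] when [x1] is deleted, so a part
   cut off by [x1] avoids the spine. *)
have conn n y : d y <= n -> y \in r :: p -> y != x1 -> connect (adj_in (A :\ x1)) y r.
  elim: n y => [|n IHn] y dy py nyx1; have [Ay _ _] := memp y py.
    by have -> : y = r by apply: injp; rewrite ?mem_head // dr; apply/eqP; rewrite -leqn0.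
  have [->//|nyr] := eqVneq y r.
  have [|pp _] := parp y; first by move: py; rewrite inE (negbTE nyr).
  have [Ap _ apy dpy] := child_prop bfsA (par_child par Ay nyr).
  have [epx1|npx1] := eqVneq (par y) x1; last first.
    have lep : d (par y) <= n by rewrite -ltnS -dpy.
    apply: connect_trans (IHn _ lep pp npx1); apply: connect1.
    by rewrite /adj_in !inE nyx1 npx1 Ay Ap adj_sym.
  have ey : y = x2 by apply: injp => //; rewrite dpy epx1 dx1 dx2.
  have lex : d x <= n by move: dy; rewrite ey dx2 ltnS; apply: ltnW.
  apply: connect_trans (IHn _ lex px nxx1).
  apply: (@connect_trans _ _ c); apply: connect1; rewrite /adj_in !inE.
    by rewrite nyx1 Ay Ac ey adj_sym acx2 eq_sym neqc.
  by rewrite nxx1 Ac Ax adj_sym axc eq_sym neqc.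
have nD y : y \in r :: p -> y != x1 -> y \notin cut_off A r x1.
  by move=> py nyx1; rewrite inE (conn _ _ (leqnn _) py nyx1) andbF.
have [_ nc'x1 _] := cut_off_sub Dc'.
rewrite in_set px1' nx1r /=; apply/andP; split.
  apply/eqP=> ex1; have [_ _] := memp x2 px2.
  by rewrite -ex1 dx1 dx2; clear; lia.
apply/existsP; exists c'; rewrite /tooth Ac' /=; apply/andP; split.
  by apply/negP=> pc'; have := nD c' pc' nc'x1; rewrite Dc'.
apply/forall_inP=> y py; rewrite orbF; apply/eqP.
have [->|nyx1] := eqVneq y x1; first by rewrite adj_sym ax1c' eqxx.
have -> : d y == d x1 = false by apply: contraNF nyx1 => /eqP/injp->.
apply/negP=> ac'y; have [Ay _ _] := memp y py.
by have := nD y py nyx1; rewrite (cut_off_adj Dc' Ay nyx1 ac'y).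
Qed.

Variable v : G -> G.
Hypothesis v_adj : {in S, forall s, v s \in A /\ adj s (v s)}.

(** If every outcome fails, the events are covered by the neighbors of fewer than [h] terminals, the
    root, the parents of fewer than [h] private spine vertices, and three sets of fewer than
    [2 ^ (h + h)] vertices, as [teeth false] counts twice: once itself and once through parents. *)
Lemma unavoidable_events :
  h + h + 1 + 3 * 2 ^ (h + h) <= count (event A r par S v) (r :: p) -> unavoidable h S.
Proof.
move=> many; have [memp injp _ _] := path_prop.
pose K := [set y in r :: p]; pose seen := [set s in S | [exists y in K, adj s y]].
have sKS : K \subset ~: S.
  by apply: subset_trans sAS; apply/subsetP=> y; rewrite in_set => /memp[].
have [few|lt_seen] := leqP h #|seen|.
  exact: unavoidable_path sKS (tree_path_is_path bfsA Ar path_p dr) few.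
have [le_false|lt_false] := leqP (2 ^ (h + h)) #|teeth false|.
  exact: unavoidable_teeth le_false.
have [le_true|lt_true] := leqP (2 ^ (h + h)) #|teeth true|.
  exact: unavoidable_teeth le_true.
(* Distinct private spine vertices have distinct terminals, all seen by the spine. *)
have lt_X : #|X :&: K| < h.
  apply: leq_ltn_trans lt_seen; have [f fP] := privateP S A.
  have injf : {in X :&: K &, injective f}.
    move=> x y /setIP[Xx _] /setIP[Xy _] exy.
    have [_ adjx] := fP x Xx; have [_ adjy] := fP y Xy.
    have Ax : x \in A by move: Xx; rewrite inE => /andP[].
    by apply/eqP; rewrite -adjy // -exy adjx.
  rewrite -(card_in_imset injf); apply/subset_leq_card/subsetP=> _ /imsetP[x /setIP[Xx Kx] ->].
  have [Sf adjf] := fP x Xx; rewrite in_set Sf; apply/exists_inP; exists x => //.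
  by rewrite adjf //; move: Xx; rewrite inE => /andP[].
pose E := [set x in r :: p | event A r par S v x].
have uniq_p : uniq (r :: p).
  have incr x q : path child x q -> path ltn (d x) (map d q).
    elim: q x => //= c q IHq x /andP[xc /IHq pq].
    by have [_ _ _ dc] := child_prop bfsA xc; rewrite pq andbT dc.
  have: sorted ltn (map d (r :: p)) by apply: incr.
  by move/(sorted_uniq ltn_trans ltnn)/map_uniq.
have cardE : count (event A r par S v) (r :: p) = #|E|.
  rewrite -size_filter -(card_uniqP (filter_uniq _ uniq_p)) /E cardsE.
  by apply: eq_card => x; rewrite mem_filter andbC.
have sE : E \subset v @: seen :|: (r |: teeth false :|: teeth true
    :|: par @: (X :&: K) :|: par @: teeth false).
  apply/subsetP=> x; rewrite in_set => /andP[px /orP[/exists_inP[s Ss /eqP vs]|br]].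
    apply/setUP; left; apply/imsetP; exists s => //; rewrite in_set Ss /=.
    apply/exists_inP; exists (v s); first by rewrite vs in_set.
    by have [] := v_adj Ss.
  by apply/setUP; right; apply: branching_spine.
have leE : #|E| <=
    #|seen| + (1 + #|teeth false| + #|teeth true| + #|X :&: K| + #|teeth false|).
  apply: leq_trans (subset_leq_card sE) _.
  apply: leq_trans (leq_card_setU _ _) (leq_add (leq_imset_card _ _) _).
  apply: leq_trans (leq_card_setU _ _) (leq_add _ (leq_imset_card _ _)).
  apply: leq_trans (leq_card_setU _ _) (leq_add _ (leq_imset_card _ _)).
  apply: leq_trans (leq_card_setU _ _) _; rewrite leq_add2r.
  by apply: leq_trans (leq_card_setU _ _) _; rewrite cards1.
move: many leE lt_seen lt_false lt_true lt_X; rewrite cardE; clear; lia.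
Qed.

End Teeth.

(** * Minimal dominating sets and the conclusion *)

Lemma root_connect (G : sgraph) (A : {set G}) r d par : bfs_tree A r d par ->
  {in A, forall x, connect (child A r par) r x}.
Proof.
move=> bfsA x; move: {2}(d x) (leqnn (d x)) => n; elim: n x => [|n IHn] x dx Ax.
all: have [->//|nxr] := eqVneq x r.
all: have [Ap _ _ dp] := child_prop bfsA (par_child par Ax nxr).
  by rewrite dp in dx.
apply: connect_trans (IHn (par x) _ Ap) (connect1 (par_child par Ax nxr)).
by rewrite -ltnS -dp.
Qed.

Definition dominates (G : sgraph) (S A : {set G}) : Prop :=
  {in S, forall s, exists2 y, y \in A & adj s y}.

(** If [A :\ x] is connected, minimality of [A] leaves some terminal without a neighbor in it; that
    terminal has [x] as its only neighbor in [A]. *)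
Lemma minimal_dominating (G : sgraph) (S A0 : {set G}) :
    connected_in A0 -> dominates S A0 ->
  exists A : {set G}, [/\ A \subset A0, connected_in A, dominates S A &
    {in A, forall x, connected_in (A :\ x) -> x \in private S A}].
Proof.
move=> conA0 domA0.
pose conb (A : {set G}) := [forall x in A, forall y in A, connect (adj_in A) x y].
pose domb (A : {set G}) := [forall s in S, exists y in A, adj s y].
have conP A : reflect (connected_in A) (conb A).
  apply: (iffP forall_inP) => [conA x y Ax|conA x Ax].
    by have /forall_inP := conA x Ax; apply.
  by apply/forall_inP=> y; apply: conA.
have domP A : reflect (dominates S A) (domb A).
  by apply: (iffP forall_inP) => domA s Ss; apply/exists_inP/domA.
have [|A /minsetP[/andP[/conP conA /domP domA] minA] sA] :=
  @minset_exists _ [pred A | conb A && domb A] A0.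
  by apply/andP; split; [apply/conP|apply/domP].
exists A; split=> // x Ax conx; rewrite in_set Ax /=; apply/exists_inP.
have [s Ss nos] : exists2 s, s \in S & ~~ [exists y in A :\ x, adj s y].
  apply/exists_inP; rewrite -negb_forall_in; apply/negP=> domx.
  have /setP/(_ x) : A :\ x = A.
    by apply: minA; rewrite ?subsetDl //; apply/andP; split; first apply/conP.
  by rewrite !inE eqxx Ax.
exists s => //; apply/forall_inP=> y Ay; apply/eqP.
have noadj u : u \in A -> u != x -> ~~ adj s u.
  move=> Au nux; apply: contra nos => su; apply/exists_inP; exists u => //.
  by rewrite !inE nux.
have [->|nyx] := eqVneq y x; last exact/negbTE/noadj.
have [u Au su] := domA s Ss; have [<-//|nux] := eqVneq u x.
by have := noadj u Au nux; rewrite su.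
Qed.

(** A childless vertex of any breadth-first tree is not a cut vertex. A second tree can then be
    rooted at a private vertex, so that the first spine vertex has its own terminal. *)
Lemma private_exists (G : sgraph) (S A : {set G}) r0 : r0 \in A -> connected_in A ->
    {in A, forall x, connected_in (A :\ x) -> x \in private S A} ->
  exists r, r \in private S A.
Proof.
move=> Ar0 conA noncutX; have [d [par bfsA]] := bfs_tree_exists conA Ar0.
have [q pq leafq] := descend bfsA Ar0.
have [/(_ _ (mem_last _ _))[Al _ _] _ _ _] := tree_path_prop bfsA Ar0 pq.
by exists (last r0 q); apply: noncutX => //; apply: (childless_noncut bfsA).
Qed.

Lemma unavoidable_large (h : nat) (G : sgraph) (S : {set G}) : 3 <= h ->
    (forall K : {set G}, clique K -> #|K| <> h) ->
    heavy_bound h (2 ^ (h + h)) (h + h + 1 + 3 * 2 ^ (h + h)) <= #|S| ->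
    0 < #|~: S| -> connected_in (~: S) -> dominates S (~: S) ->
  unavoidable h S.
Proof.
move=> h_ge3 no_clique leS; case/card_gt0P=> y0 _ conS domS.
have [A [sAS conA domA noncutX]] := minimal_dominating conS domS.
have [/exists_inP[a Aa high]|low] := boolP [exists a in A,
  2 ^ (h + h) <= #|[set w in A | adj a w]|].
  have [d [par bfsA]] := bfs_tree_exists conA Aa.
  exact: unavoidable_high_degree bfsA noncutX high.
rewrite negb_exists_in in low; move/forall_inP: low => low.
have vP s : exists y, s \in S -> y \in A /\ adj s y.
  have [Ss|_] := boolP (s \in S); last by exists s.
  by have [y Ay sy] := domA s Ss; exists y.
have {vP}[v vP] := fin_all_exists vP.
have S_gt0 : 0 < #|S| by apply: leq_trans leS; rewrite heavy_bound_gt0 // addn1.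
have [r0 Ar0] : exists r0, r0 \in A.
  by case/card_gt0P: S_gt0 => s /vP[Av _]; exists (v s).
have [r Xr] := private_exists Ar0 conA noncutX.
have Ar : r \in A by move: Xr; rewrite inE => /andP[].
have [d [par bfsA]] := bfs_tree_exists conA Ar.
(* If [h] terminals choose the same neighbor, that single vertex is the required path. *)
have [/exists_inP[a Aa many]|few] := boolP [exists a in A, h <= #|[set s in S | v s == a]|].
  have [d' [par' bfsA']] := bfs_tree_exists conA Aa.
  have da : d' a = 0 by have [] := bfsA'.
  apply: (unavoidable_path _ (tree_path_is_path (q := [::]) bfsA' Aa isT da)).
    by apply/subsetP=> y; rewrite !in_set mem_seq1 => /eqP->;
      have := subsetP sAS _ Aa; rewrite in_set.
  apply: leq_trans many _; apply/subset_leq_card/subsetP=> s.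
  rewrite !in_set => /andP[Ss /eqP vs].
  rewrite Ss; apply/exists_inP; exists a; first by rewrite in_set mem_head.
  by have [_] := vP s Ss; rewrite vs.
rewrite negb_exists_in in few; move/forall_inP: few => few.
(* Fewer than [h] terminals choose any one vertex, and children are neighbors, so [h] and the degree
   bound serve as [m] and [D]. *)
have [|||p [path_p leaf_p many]] := heavy_path bfsA (S := S) (v := v) (m := h)
  (D := 2 ^ (h + h)) _ _ (k := h + h + 1 + 3 * 2 ^ (h + h)) Ar.
- by move=> a Aa; rewrite ltnW // ltnNge few.
- move=> a Aa; apply: leq_trans (_ : #|[set w in A | adj a w]| <= _).
    apply/subset_leq_card/subsetP=> c; rewrite !in_set => ac.
    by have [_ -> -> _] := child_prop bfsA ac.
  by rewrite ltnW // ltnNge low.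
- apply: leq_trans leS _; apply/subset_leq_card/subsetP=> s Ss; rewrite in_set Ss.
  by have [Av _] := vP s Ss; apply: (root_connect bfsA).
exact: (unavoidable_events h_ge3 no_clique sAS bfsA noncutX path_p leaf_p Xr vP many).
Qed.

Theorem theorem5p4 (h' : nat) (h'_ge1 : 1 <= h') :
  exists nu : nat, 1 <= nu /\
  forall G : sgraph,
    connected_graph G ->
    (forall K : {set G}, clique K -> #|K| <> h') ->
  forall S' : {set G},
    nu <= #|S'| ->
    connected_graph (induced (~: S')) ->
    (forall s : G, s \in S' -> exists2 y : G, y \in ~: S' & adj s y) ->
  exists St : {set G}, exists A : {set G},
    [/\ St \subset S', #|St| = h', A \subset ~: S' &
      (is_path (induced A) /\
       forall s : G, s \in St -> exists2 y : G, y \in A & adj s y)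
      \/
      [/\ is_caterpillar (induced A) \/
          is_line_graph_of_caterpillar (induced A) \/
          is_subdivided_star (induced A),
          forall s : G, s \in St -> exists! y : G, y \in A /\ adj s y &
          A :&: set_nbhd St = [set val x | x in simplicials (induced A)]]].
Proof.
(* The arguments bound the terminals stopping at a vertex, the children of a vertex, and the number
   of events that force an outcome. *)
exists (heavy_bound h' (2 ^ (h' + h')) (h' + h' + 1 + 3 * 2 ^ (h' + h'))).
split=> [|G _ no_clique S' leS conS domS]; first by rewrite heavy_bound_gt0 // addn1.
have [h'_ge3|h'_lt3] := leqP 3 h'.
  have [S_gt0 _] := conS; rewrite card_sig in S_gt0.
  exact: unavoidable_large h'_ge3 no_clique leS S_gt0 (connected_induced conS) domS.
(* For [h'] below three the clique hypothesis is contradicted: a terminal is a clique of size one,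
   and with a neighbor it forms one of size two. *)
have /card_gt0P[s Ss] : 0 < #|S'| by apply: leq_trans leS; rewrite heavy_bound_gt0 // addn1.
have [y _ sy] := domS s Ss.
have [h1|h2] : h' = 1 \/ h' = 2 by lia.
  by case: (no_clique [set s]); rewrite ?cards1 // => u w /set1P-> /set1P->; rewrite eqxx.
case: (no_clique [set s; y]); last first.
  by rewrite cards2 h2; case: eqVneq sy => // ->; rewrite adj_irr.
by move=> u w /set2P[]-> /set2P[]->; rewrite ?eqxx // adj_sym.
Qed.
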